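(* Let $k$ be the residue field of a $p$-modular system, with $\mathrm{char}\,k=p>2$. For $0<m<p-1$ and every $p$-regular partition $\lambda\in\Lambda_{\le p}^\ast$ we have $$[\Delta_{(p-m,1^m)}^k(p;p-1):L_\lambda^k(p;p-1)]=\begin{cases}1&\text{if }\lambda=(p-m,1^m)\text{ or }\lambda=(p-m+1,1^{m-1}),\\0&\text{otherwise.}\end{cases}$$ For $m=0$ we have $\Delta_{(p)}^k(p;p-1)\cong L_{(p)}^k(p;p-1)$. For $m=p-1$ we have $\Delta_{(1^p)}^k(p;p-1)\cong L_{(2,1^{p-2})}^k(p;p-1)$.
   Context: A $p$-modular system $(K,R,k)$ consists of a discrete valuation ring $R$ with maximal ideal $(\pi)$, field of fractions $K$ of characteristic $0$ and residue field $k=R/(\pi)$ of characteristic $p$. The parameter $p-1$ is regarded as an element of $k$. Partitions: $\Lambda_{\leq n}$ is the set of all partitions of integers $0\le i\le n$, and $\Lambda_{\leq n}^\ast$ the subset of $p$-regular ones (no non-zero part repeated $p$ or more times). Exponents denote repeated parts. Partition algebra: $P_n^k(\delta)$ is the $k$-algebra with basis the set-partitions of $\{1,\dots,n,\bar1,\dots,\bar n\}$ (diagrams with northern nodes $1,\dots,n$ and southern nodes $\bar1,\dots,\bar n$); the product $xy$ is obtained by placing $x$ on top of $y$, identifying southern nodes of $x$ with northern nodes of $y$, removing the $t$ blocks lying entirely in the middle row, and multiplying by $\delta^t$. A block of a diagram is propagating if it contains both a northern and a southern node. Cell modules: for a partition $\lambda\vdash t\le n$, let $V(n,t)$ be the $k$-vector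 space with basis the diagrams having exactly $t$ propagating blocks and in which $\overline{t+1},\dots,\bar n$ are singleton blocks; $\mathfrak{S}_t$ acts on the right by permuting the southern nodes $\bar1,\dots,\bar t$. Put $\Delta_\lambda^k(n;\delta)=V(n,t)\otimes_{\mathfrak{S}_t}S^\lambda_k$, where $S^\lambda_k$ is the Specht module (James' convention: for $p$-regular $\lambda$, $S_k^\lambda$ has simple head $D_k^\lambda$), with $x(v\otimes s)=(xv)\otimes s$ if $xv$ has $t$ propagating blocks and $0$ otherwise. For $\delta\ne0$ in $k$ and $p$-regular $\lambda$, $\Delta_\lambda^k(n;\delta)$ has a simple head $L_\lambda^k(n;\delta)$, and these form a complete set of non-isomorphic simple $P_n^k(\delta)$-modules. $[M:L]$ denotes the multiplicity of the simple module $L$ as a composition factor of $M$. *)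

(* Defs.v *)
From HB Require Import structures.
From mathcomp Require Import all_boot all_order all_fingroup all_algebra.
From mathcomp Require Import boolp ring.

Set Implicit Arguments.
Unset Strict Implicit.
Unset Printing Implicit Defensive.

Import GRing.Theory.

Section ModularSystem.
Local Open Scope ring_scope.

Definition is_ideal (R : idomainType) (I : R -> Prop) : Prop :=
  [/\ I 0, forall x y, I x -> I y -> I (x + y) & forall a x, I x -> I (a * x)].

Definition principal_ideal (R : idomainType) (a x : R) : Prop :=
  exists b, x = b * a.

(* R is a principal ideal domain, not a field, whose non-units form the
   ideal (pi); hence (pi) is its only maximal ideal. *)
Record discrete_valuation_ring (R : idomainType) (pi : R) : Prop := {
  dvr_principal : forall I : R -> Prop, is_ideal I ->
    exists a, forall x, I x <-> principal_ideal a x;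
  dvr_neq0 : pi != 0;
  dvr_local : forall x, (x \isn't a GRing.unit) <-> principal_ideal pi x }.

(* K is the fraction field of R, and k = R/(pi) is presented by a surjective
   morphism from R to k with kernel (pi). *)
Record p_modular_system (p : nat) (R : idomainType) (pi : R) (k : fieldType)
    (res : {rmorphism R -> k}) : Prop := {
  pms_dvr : discrete_valuation_ring pi;
  pms_fraction : [pchar {fraction R}] =i pred0;
  pms_surj : forall y : k, exists x, res x = y;
  pms_ker : forall x, res x = 0 <-> principal_ideal pi x;
  pms_residue : p \in [pchar k] }.

End ModularSystem.

Definition is_partition (la : seq nat) : bool :=
  sorted geq la && (0 \notin la).

Definition p_regular (p : nat) (la : seq nat) : bool :=
  all (fun x => count_mem x la < p) la.

(* Membership in the set of p-regular partitions of the integers 0, ..., n *)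
Definition regular_partition_le (p n : nat) (la : seq nat) : bool :=
  [&& is_partition la, sumn la <= n & p_regular p la].

Local Open Scope ring_scope.
Local Open Scope quotient_scope.

Record submodule (A : nzRingType) (M : lmodType A) := Submodule {
  submod_mem :> {pred M};
  submod_memP : submod_closed submod_mem }.

Section Submodule.
Variables (A : nzRingType) (M : lmodType A) (U : submodule M).

HB.instance Definition _ :=
  GRing.isSubmodClosed.Build A M (submod_mem U) (submod_memP U).

Definition submod_type : Type := {x : M | x \in (submod_mem U)}.
HB.instance Definition _ := SubType.on submod_type.
HB.instance Definition _ := Choice.on submod_type.
HB.instance Definition _ := SubChoice.on submod_type.
HB.instance Definition _ := [SubChoice_isSubLmodule of submod_type by <:].

Definition quotient_module : Type := Quotient.quot (submod_mem U).
HB.instance Definition _ := GRing.Zmodule.on quotient_module.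
HB.instance Definition _ := EqQuotient.on quotient_module.

Definition quotient_scale (a : A) : quotient_module -> quotient_module :=
  lift_op1 quotient_module (fun x : M => a *: x).

Lemma pi_scale a : {morph \pi_quotient_module : x / a *: x >-> quotient_scale a x}.
Proof.
move=> x; unlock quotient_scale; apply/eqP.
rewrite -Quotient.idealrBE -scalerBr rpredZ //.
by rewrite Quotient.idealrBE reprK.
Qed.

Lemma pi_addq : {morph \pi_quotient_module : x y / x + y}.
Proof. exact: (@Quotient.pi_add M (submod_mem U)). Qed.

Lemma quotient_scaleA a b q :
  quotient_scale a (quotient_scale b q) = quotient_scale (a * b) q.
Proof. by rewrite -[q]reprK -!pi_scale scalerA. Qed.

Lemma quotient_scale1 : left_id 1 quotient_scale.
Proof. by move=> q; rewrite -[q]reprK -pi_scale scale1r. Qed.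

Lemma quotient_scaleDr : right_distributive quotient_scale +%R.
Proof.
move=> a q r; rewrite -[q]reprK -[r]reprK -!pi_scale -!pi_addq.
by rewrite -pi_scale scalerDr.
Qed.

Lemma quotient_scaleDl q : {morph quotient_scale^~ q : a b / a + b}.
Proof.
by move=> a b; rewrite -[q]reprK -!pi_scale -pi_addq scalerDl.
Qed.

HB.instance Definition _ := GRing.Zmodule_isLmodule.Build A quotient_module
  quotient_scaleA quotient_scale1 quotient_scaleDr quotient_scaleDl.

End Submodule.

Section Modules.
Variable A : nzRingType.
Implicit Types M N : lmodType A.

Definition isomorphic M N := exists f : {linear M -> N}, bijective f.

Definition simple_module M :=
  (exists x : M, x != 0) /\
  forall U : submodule M, U =i pred1 0 \/ U =i predT.

Definition maximal_submodule M (U : submodule M) :=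
  ~ (U =i predT) /\
  forall V : submodule M, {subset U <= V} -> V =i U \/ V =i predT.

Lemma restrict_closed M (U V : submodule M) :
  submod_closed [pred x : submod_type U | val x \in V].
Proof.
have [V0 VL] := submod_memP V.
by split=> [|a x y]; rewrite !inE //= => xV yV; apply: VL.
Qed.

(* U / (U :&: V), which is U / V when V is contained in U *)
Definition subquotient M (U V : submodule M) : lmodType A :=
  quotient_module (Submodule (restrict_closed U V)).

Lemma radical_closed M : submod_closed
  [pred x : M | `[< forall U : submodule M, maximal_submodule U -> x \in U >]].
Proof.
split=> [|a x y]; rewrite !inE.
  by apply/asboolP=> U _; have [] := submod_memP U.
move=> /asboolP xU /asboolP yU; apply/asboolP=> U maxU.
by have [_] := submod_memP U; apply; [apply: xU | apply: yU].
Qed.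

(* The intersection of the maximal submodules *)
Definition radical M : submodule M := Submodule (@radical_closed M).
Definition module_head M : lmodType A := quotient_module (radical M).

Definition composition_series M (r : nat) (U : nat -> submodule M) :=
  [/\ U 0%N =i pred1 0, U r =i predT &
      forall i, (i < r)%N ->
        {subset U i <= U i.+1} /\ simple_module (subquotient (U i.+1) (U i))].

(* By Jordan-Holder, the count does not depend on the composition series. *)
Definition composition_multiplicity M L (c : nat) :=
  exists r, exists U : nat -> submodule M, composition_series r U /\
    #|[set i : 'I_r | `[< isomorphic (subquotient (U i.+1) (U i)) L >]]| = c.

End Modules.

Local Close Scope quotient_scope.
Local Close Scope ring_scope.

(* inl i is the northern node i + 1, inr i the southern one. *)
Notation node n := ('I_n + 'I_n)%type.

Record diagram n := Diagram {
  blocks :> {set {set node n}};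
  _ : partition blocks [set: node n] }.
HB.instance Definition _ n := [isSub for @blocks n].
HB.instance Definition _ n := [Finite of diagram n by <:].

(* Top, middle and bottom rows of a diagram placed on top of another *)
Notation stack n := ('I_n + 'I_n + 'I_n)%type.

Definition upper n (a : node n) : stack n := inl a.
Definition lower n (a : node n) : stack n :=
  match a with inl i => inl (inr i) | inr i => inr i end.
Definition outer n (a : node n) : stack n :=
  match a with inl i => inl (inl i) | inr i => inr i end.

Section Compose.
Variables (n : nat) (x y : diagram n).

Definition stacked_blocks : {set {set stack n}} :=
  [set (@upper n) @: (B : {set node n}) | B in blocks x]
  :|: [set (@lower n) @: (B : {set node n}) | B in blocks y].

Definition glued : rel (stack n) :=
  [rel u v | [exists C in stacked_blocks, (u \in C) && (v \in C)]].

Definition components : {set {set stack n}} :=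
  equivalence_partition (connect glued) [set: stack n].

Lemma glued_sym : connect_sym glued.
Proof.
apply: sym_connect_sym => u v; apply/existsP/existsP=> -[C];
by case/and3P=> CP uC vC; exists C; rewrite CP uC vC.
Qed.

Lemma glued_equiv : equivalence_rel (connect glued).
Proof.
move=> u v w; split=> [|uv]; first exact: connect0.
by rewrite (same_connect glued_sym uv).
Qed.

Definition compose_blocks : {set {set node n}} :=
  equivalence_partition
    [rel a b | connect glued (outer a) (outer b)] [set: node n].

Lemma compose_partition : partition compose_blocks [set: node n].
Proof.
apply: equivalence_partitionP => a b c _ _ _.
exact: (glued_equiv (outer a) (outer b) (outer c)).
Qed.

End Compose.

(* Locked, as unification could otherwise try to enumerate diagrams *)
HB.lock Definition loops n (x y : diagram n) : nat :=
  #|[set C in components x y | C \subset [set inl (inr i) | i : 'I_n]]|.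

HB.lock Definition compose n (x y : diagram n) : diagram n :=
  Diagram (compose_partition x y).

Arguments loops {n} x y.
Arguments compose {n} x y.

Lemma id_partition n :
  partition (preim_partition (fun a : node n => match a with inl i | inr i => i end)
     [set: node n]) [set: node n].
Proof. exact: preim_partitionP. Qed.

Definition id_diagram n : diagram n := Diagram (id_partition n).

Definition same_block n (d : diagram n) (a b : node n) := b \in pblock d a.

Section Same.
Variables (n : nat) (d : diagram n).

Lemma diagramP : partition d [set: node n]. Proof. by case: d. Qed.
Lemma diagram_cover a : a \in cover d. Proof. by rewrite (cover_partition diagramP) inE. Qed.
Lemma diagram_trivIset : trivIset d. Proof. exact: partition_trivIset diagramP. Qed.
Lemma same_blockE a b : same_block d a b = (pblock d a == pblock d b).
Proof. by rewrite eq_pblock ?diagram_trivIset ?diagram_cover. Qed.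
Lemma same_refl a : same_block d a a. Proof. by rewrite same_blockE. Qed.
Lemma same_sym a b : same_block d a b = same_block d b a. Proof. by rewrite !same_blockE eq_sym. Qed.
Lemma same_left a b : same_block d a b -> same_block d a =1 same_block d b.
Proof. by rewrite same_blockE => /eqP e c; rewrite !same_blockE e. Qed.
Lemma same_blockP a b : reflect (exists2 B, B \in blocks d & (a \in B) && (b \in B)) (same_block d a b).
Proof.
apply: (iffP idP) => [ab|[B Bd /andP[aB bB]]].
  by exists (pblock d a); rewrite ?pblock_mem ?mem_pblock ?diagram_cover //.
by rewrite /same_block (def_pblock diagram_trivIset Bd aB).
Qed.
End Same.

Lemma diagram_ext n (d e : diagram n) : same_block d =2 same_block e -> d = e.
Proof.
move=> de; apply/val_inj => /=.
rewrite -(equivalence_partition_pblock (diagramP d)) -(equivalence_partition_pblock (diagramP e)).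
by apply: eq_imset => a; apply/setP=> b; rewrite !inE; exact: de.
Qed.

Lemma same_compose n (x y : diagram n) a b :
  same_block (compose x y) a b = connect (glued x y) (outer a) (outer b).
Proof.
rewrite compose.unlock /same_block pblock_equivalence_partition ?inE // => u v w _ _ _.
exact: (glued_equiv x y (outer u) (outer v) (outer w)).
Qed.

Lemma same_preim n (T : eqType) (f : node n -> T) H a b :
  same_block (@Diagram n (preim_partition f [set: node n]) H) a b = (f a == f b).
Proof.
rewrite /same_block /= /preim_partition pblock_equivalence_partition ?inE //.
by move=> u v w _ _ _; split=> // /eqP->.
Qed.

Lemma glued_ind n (x y : diagram n) (Q : stack n -> Prop) :
  (forall a b, same_block x a b -> Q (upper a) -> Q (upper b)) ->
  (forall a b, same_block y a b -> Q (lower a) -> Q (lower b)) ->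
  forall u v, connect (glued x y) u v -> Q u -> Q v.
Proof.
move=> Hx Hy u v /connectP[s].
elim: s u => [|w s IH] u /=; first by move=> _ ->.
case/andP=> /existsP[C /and3P[CP uC wC]] sP vE Qu; apply: (IH w) => //.
case/setUP: CP uC wC => /imsetP[B BP ->] /imsetP[a aB ua] /imsetP[b bB wb].
  by rewrite wb; apply: Hx (a) _ _ _; rewrite -?ua //; apply/same_blockP; exists B; rewrite ?aB.
by rewrite wb; apply: Hy (a) _ _ _; rewrite -?ua //; apply/same_blockP; exists B; rewrite ?aB.
Qed.

Lemma glued_upper n (x y : diagram n) a b :
  same_block x a b -> connect (glued x y) (upper a) (upper b).
Proof.
case/same_blockP=> B Bx /andP[aB bB]; apply/connect1/existsP.
by exists ((@upper n) @: B); rewrite !imset_f // inE imset_f.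
Qed.
Lemma glued_lower n (x y : diagram n) a b :
  same_block y a b -> connect (glued x y) (lower a) (lower b).
Proof.
case/same_blockP=> B Bx /andP[aB bB]; apply/connect1/existsP.
by exists ((@lower n) @: B); rewrite !imset_f // inE (imset_f _ Bx) orbT.
Qed.

(* Associativity comes from transfer matrices: transfer d f h is 1 if colouring
   the northern nodes by f and the southern ones by h is constant on the blocks
   of d, and 0 otherwise. These matrices determine d, and their product counts
   the colourings of the middle row, 2 for each removed block. *)
Notation colouring n := {ffun 'I_n -> bool}.
Definition join_colouring n (f g : colouring n) (a : node n) : bool :=
  match a with inl i => f i | inr i => g i end.
Definition block_constant n (d : diagram n) (h : node n -> bool) :=
  [forall a, forall b, same_block d a b ==> (h a == h b)].
Lemma block_constantP n (d : diagram n) h :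
  reflect (forall a b, same_block d a b -> h a = h b) (block_constant d h).
Proof.
apply: (iffP forallP) => [H a b ab|H a]; last by apply/forallP=> b; apply/implyP=> /H->.
by apply/eqP; move/forallP: (H a) => /(_ b)/implyP; apply.
Qed.

Section Count.
Variables (n : nat) (x y : diagram n) (f h : colouring n).
Let E := connect (glued x y).
Let Esym : connect_sym (glued x y) := glued_sym x y.

Definition stack3 (g : colouring n) (u : stack n) : bool :=
  match u with inl (inl i) => f i | inl (inr i) => g i | inr i => h i end.

Lemma stack3_inv g :
  reflect (forall u v, E u v -> stack3 g u = stack3 g v)
          (block_constant x (join_colouring f g) && block_constant y (join_colouring g h)).
Proof.
have up a : stack3 g (upper a) = join_colouring f g a by case: a.
have lo a : stack3 g (lower a) = join_colouring g h a by case: a.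
apply: (iffP andP) => [[/block_constantP cx /block_constantP cy] u v|H].
  move=> uv; apply: (glued_ind (Q := fun w => stack3 g u = stack3 g w)) uv (erefl _).
    by move=> a b ab ->; rewrite !up; apply: cx.
  by move=> a b ab ->; rewrite !lo; apply: cy.
split; apply/block_constantP=> a b ab.
  by rewrite -!up; apply: H; apply: glued_upper.
by rewrite -!lo; apply: H; apply: glued_lower.
Qed.

Let comp u := pblock (components x y) u.
Let compE u v : (v \in comp u) = E u v.
Proof.
rewrite /comp /components pblock_equivalence_partition ?inE // => a b c _ _ _.
exact: glued_equiv.
Qed.
Let L := [set C in components x y | C \subset [set inl (inr i) | i : 'I_n]].

Let ext (D : {set {set stack n}}) u := if [pick a | E u (outer a)] is Some a then join_colouring f h a
               else comp u \in D.
Let phi (D : {set {set stack n}}) : colouring n := [ffun m => ext D (inl (inr m))].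

Let compL u : (forall a, ~~ E u (outer a)) -> comp u \in L.
Proof.
move=> H; rewrite inE; apply/andP; split.
  by rewrite pblock_mem // (cover_partition (equivalence_partitionP _)) ?inE //
     => a b c _ _ _; exact: glued_equiv.
apply/subsetP=> v; rewrite compE => uv.
case: v uv => [[i|i]|i] uv; last 1 [have := H (inr i)] || idtac.
- by have := H (inl i); rewrite uv.
- exact: imset_f.
- by rewrite uv.
Qed.

Lemma compat_comp g : block_constant x (join_colouring f g) && block_constant y (join_colouring g h) -> block_constant (compose x y) (join_colouring f h).
Proof.
move/stack3_inv=> H; apply/block_constantP=> a b; rewrite same_compose => /H.
by case: a => i; case: b => j.
Qed.

Lemma count_mid :
  #|[set g | block_constant x (join_colouring f g) && block_constant y (join_colouring g h)]|
  = if block_constant (compose x y) (join_colouring f h) then 2 ^ loops x y else 0.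
Proof.
case: ifPn => [/block_constantP cxy|ncxy]; last first.
  by apply/eqP; rewrite cards_eq0; apply/eqP/setP=> g; rewrite !inE;
     apply: contraNF ncxy; apply: compat_comp.
rewrite loops.unlock -card_powerset -/L -(card_in_imset (f := phi)).
  congr #|pred_of_set _|; apply/setP=> g; rewrite inE; apply/idP/imsetP.
    move/stack3_inv=> H.
    exists [set C in L | [exists u in C, stack3 g u]].
      by rewrite inE; apply/subsetP=> C; rewrite !inE => /andP[].
    apply/ffunP=> m; rewrite ffunE /ext.
    case: pickP => [a|no].
      by move/H => /= ->; case: a.
    rewrite inE compL /=; last by move=> a; rewrite no.
    apply/idP/existsP=> [gm|[v]].
      by exists (inl (inr m)); rewrite compE /E connect0.
    by rewrite compE => /andP[/H<-].
  case=> D; rewrite inE => DL ->; apply/stack3_inv.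
  have extE u : stack3 (phi D) u = ext D u.
    have oE a : join_colouring f h a = ext D (outer a).
      rewrite /ext; case: pickP => [b|/(_ a)]; last by rewrite /E connect0.
      by rewrite /E -same_compose => /cxy.
    case: u => [[i|i]|i] /=; first exact: (oE (inl i)).
      by rewrite ffunE.
    exact: (oE (inr i)).
  move=> u v uv; rewrite !extE /ext.
  have -> : [pick a | E u (outer a)] = [pick a | E v (outer a)].
    by apply: eq_pick => a; exact: (same_connect Esym uv (outer a)).
  case: pickP => // _; suff -> : comp u = comp v by [].
  by apply/setP=> w; rewrite !compE; exact: (same_connect Esym uv w).
move=> D1 D2; rewrite !powersetE => /subsetP s1 /subsetP s2 e12.
suff H C : C \in L -> (C \in D1) = (C \in D2).
  apply/setP=> C; apply/idP/idP=> CD.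
    by rewrite -H ?s1.
  by rewrite H ?s2.
rewrite inE => /andP[Cc /subsetP Cm].
have /and3P[_ Ctriv Cn0] : partition (components x y) setT.
  by apply: equivalence_partitionP => a b c _ _ _; exact: glued_equiv.
have /set0Pn[u uC] : C != set0 by apply: contraNneq Cn0 => <-.
have /imsetP[m _ um] := Cm _ uC.
have CE : C = comp u by rewrite /comp (def_pblock Ctriv Cc uC).
move/ffunP/(_ m): e12; rewrite !ffunE /ext -um -CE.
case: pickP => // a; rewrite -compE -CE => /Cm /imsetP[j _].
by case: a.
Qed.
End Count.

Definition transfer n (d : diagram n) (f h : colouring n) : nat := block_constant d (join_colouring f h).

Lemma transfer_mul n (x y : diagram n) f h :
  \sum_g transfer x f g * transfer y g h = 2 ^ loops x y * transfer (compose x y) f h.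
Proof.
have := count_mid x y f h; rewrite -sum1_card /transfer => e.
rewrite big_mkcond /= in e.
transitivity (if block_constant (compose x y) (join_colouring f h) then 2 ^ loops x y else 0); last first.
  by case: ifP; rewrite ?muln1 ?muln0.
rewrite -e; apply: eq_bigr => g _; rewrite inE.
by case: (block_constant x _); case: (block_constant y _).
Qed.

Lemma transfer_inj n (d e : diagram n) r s :
  (forall f h, 2 ^ r * transfer d f h = 2 ^ s * transfer e f h) -> r = s /\ d = e.
Proof.
move=> H; have rs : r = s.
  have Z1 c : @transfer n c [ffun=> true] [ffun=> true] = 1.
    rewrite /transfer; suff -> : block_constant c (join_colouring [ffun=> true] [ffun=> true]) by [].
    by apply/block_constantP=> -[i|i] [j|j] _ /=; rewrite !ffunE.
  by have := H [ffun=> true] [ffun=> true]; rewrite !Z1 !muln1 => /eqP; rewrite eqn_exp2l // => /eqP.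
split=> //; subst s.
have Zde f h : block_constant d (join_colouring f h) = block_constant e (join_colouring f h).
  have /eqP := H f h; rewrite eqn_pmul2l ?expn_gt0 // /transfer.
  by do 2 case: (block_constant _ _).
have sub c1 c2 : (forall f h, block_constant c1 (join_colouring f h) = block_constant c2 (@join_colouring n f h)) ->
    forall a b, same_block c1 a b -> same_block c2 a b.
  move=> cc a b ab.
  have jE : join_colouring [ffun i => same_block c2 a (inl i)] [ffun i => same_block c2 a (inr i)] =1 same_block c2 a.
    by case=> i /=; rewrite ffunE.
  have /block_constantP : block_constant c1 (join_colouring [ffun i => same_block c2 a (inl i)] [ffun i => same_block c2 a (inr i)]).
    by rewrite cc; apply/block_constantP=> u v uv; rewrite !jE !(same_sym c2 a) (same_left uv).
  by move=> /(_ a b ab); rewrite !jE same_refl.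
by apply: diagram_ext => a b; apply/idP/idP; apply: sub => // f h; rewrite Zde.
Qed.

Lemma compose_assoc n (x y z : diagram n) :
  loops x (compose y z) + loops y z = loops x y + loops (compose x y) z /\
  compose x (compose y z) = compose (compose x y) z.
Proof.
have powD a b c : 2 ^ (a + b) * c = 2 ^ a * (2 ^ b * c) by rewrite expnD mulnA.
apply: transfer_inj => f h.
transitivity (\sum_g1 \sum_g2 transfer x f g1 * (transfer y g1 g2 * transfer z g2 h)).
  rewrite [in LHS]addnC powD -(transfer_mul x (compose y z) f h).
  move: (loops y z) (transfer_mul y z) => l e.
  rewrite big_distrr; apply: eq_bigr => g1 _.
  by rewrite -big_distrr /= e mulnCA.
rewrite powD -(transfer_mul (compose x y) z f h).
move: (loops x y) (transfer_mul x y) => l e.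
rewrite exchange_big big_distrr; apply: eq_bigr => g2 _.
by rewrite /= mulnA -e big_distrl; apply: eq_bigr => g1 _; rewrite mulnA.
Qed.

Lemma transfer_id n (f h : colouring n) : transfer (id_diagram n) f h = (f == h).
Proof.
rewrite /transfer; congr nat_of_bool; apply/block_constantP/eqP => [H|-> a b].
  apply/ffunP=> i; have := H (inl i) (inr i); rewrite /id_diagram same_preim; exact.
by rewrite /id_diagram same_preim; case: a; case: b => i j /= /eqP->.
Qed.

Lemma compose_id n (x : diagram n) :
  (loops x (id_diagram n) = 0 /\ compose x (id_diagram n) = x) /\
  (loops (id_diagram n) x = 0 /\ compose (id_diagram n) x = x).
Proof.
split; apply: transfer_inj => f h; rewrite -transfer_mul expn0 mul1n.
  rewrite (bigD1 h) //= transfer_id eqxx muln1 big1 ?addn0 // => g /negPf gh.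
  by rewrite transfer_id gh muln0.
rewrite (bigD1 f) //= transfer_id eqxx mul1n big1 ?addn0 // => g gf.
by rewrite transfer_id eq_sym (negPf gf).
Qed.

Local Open Scope ring_scope.

Definition partition_algebra (k : fieldType) (n : nat) (delta : k) : Type :=
  {ffun diagram n -> k}.

Section PartitionAlgebra.
Variables (k : fieldType) (n : nat) (delta : k).
Local Notation P := (partition_algebra n delta).

HB.instance Definition _ := GRing.Lmodule.copy P {ffun diagram n -> k^o}.

Definition palg_basis (d : diagram n) : P := [ffun e => (e == d)%:R].

Definition palg_mul (a b : P) : P :=
  \sum_(x : diagram n) \sum_(y : diagram n)
    (a x * b y * delta ^+ loops x y) *: palg_basis (compose x y).

Lemma palg_basisE d e : palg_basis d e = (e == d)%:R.
Proof. exact: ffunE. Qed.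

Lemma palg_scaleE c (a : P) d : (c *: a) d = c * a d.
Proof. exact: ffunE. Qed.

Lemma palg_mulE a b z : palg_mul a b z =
  \sum_x \sum_y a x * b y * delta ^+ loops x y * (compose x y == z)%:R.
Proof.
rewrite sum_ffunE; apply: eq_bigr => x _; rewrite sum_ffunE.
by apply: eq_bigr => y _; rewrite !ffunE eq_sym.
Qed.

Lemma palg_mul_sum (V : lmodType k) a b (F : diagram n -> V) :
  \sum_z palg_mul a b z *: F z =
  \sum_x \sum_y (a x * b y * delta ^+ loops x y) *: F (compose x y).
Proof.
transitivity (\sum_z \sum_x \sum_y
    (a x * b y * delta ^+ loops x y * (compose x y == z)%:R) *: F z).
  apply: eq_bigr => z _; rewrite palg_mulE scaler_suml.
  by apply: eq_bigr => x _; rewrite scaler_suml.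
rewrite exchange_big; apply: eq_bigr => x _.
rewrite exchange_big; apply: eq_bigr => y _.
rewrite (bigD1 (compose x y)) //= eqxx mulr1 big1 ?addr0 // => z /negPf zxy.
by rewrite eq_sym zxy mulr0 scale0r.
Qed.

Lemma palg_sum_basis (a : P) : \sum_x a x *: palg_basis x = a.
Proof.
apply/ffunP=> z; rewrite sum_ffunE.
transitivity (\sum_x a x * (z == x)%:R).
  by apply: eq_bigr => x _; rewrite palg_scaleE palg_basisE.
rewrite (bigD1 z isT) /= eqxx mulr1 big1 ?addr0 // => x /negPf xz.
by rewrite eq_sym xz mulr0.
Qed.

Lemma palg_mulA : associative palg_mul.
Proof.
move=> a b c; transitivity (\sum_x \sum_y \sum_z
   (a x * b y * c z * delta ^+ (loops x y + loops (compose x y) z)) *: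
     palg_basis (compose (compose x y) z)).
  apply: eq_bigr => x _.
  transitivity (\sum_w palg_mul b c w *:
      ((a x * delta ^+ loops x w) *: palg_basis (compose x w))).
    apply: eq_bigr => w _; rewrite scalerA; congr (_ *: _).
    by rewrite mulrCA mulrA.
  rewrite palg_mul_sum; apply: eq_bigr => y _; apply: eq_bigr => z _.
  have [<- <-] := compose_assoc x y z; rewrite scalerA exprD; congr (_ *: _).
  move: (a x) (b y) (c z) (delta ^+ loops x _) (delta ^+ loops y z).
  by move=> r1 r2 r3 r4 r5; ring.
have /= E := palg_mul_sum a b (fun w => \sum_z (c z * delta ^+ loops w z) *: palg_basis (compose w z)).
transitivity (\sum_x \sum_y (a x * b y * delta ^+ loops x y) *:
   (\sum_z (c z * delta ^+ loops (compose x y) z) *: palg_basis (compose (compose x y) z))).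
  apply: eq_bigr => x _; apply: eq_bigr => y _; rewrite scaler_sumr.
  apply: eq_bigr => z _; rewrite scalerA exprD; congr (_ *: _).
  move: (a x) (b y) (c z) (delta ^+ loops x _) (delta ^+ loops _ z).
  by move=> r1 r2 r3 r4 r5; ring.
rewrite -E; apply: eq_bigr => w _; rewrite scaler_sumr; apply: eq_bigr => z _.
by rewrite scalerA mulrA.
Qed.

Lemma palg_mulDl : left_distributive palg_mul +%R.
Proof.
move=> a b c; rewrite /palg_mul -big_split; apply: eq_bigr => x _ /=.
rewrite -big_split; apply: eq_bigr => y _ /=.
by rewrite ffunE -scalerDl !mulrDl.
Qed.

Lemma palg_mulDr : right_distributive palg_mul +%R.
Proof.
move=> a b c; rewrite /palg_mul -big_split; apply: eq_bigr => x _ /=.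
rewrite -big_split; apply: eq_bigr => y _ /=.
by rewrite ffunE -scalerDl mulrDr !mulrDl.
Qed.

Definition palg_one : P := palg_basis (id_diagram n).

Lemma palg_mul1l : left_id palg_one palg_mul.
Proof.
move=> a; rewrite /palg_mul (bigD1 (id_diagram n)) //= [X in _ + X]big1 ?addr0.
  rewrite -[RHS]palg_sum_basis; apply: eq_bigr => y _.
  by have [_ [-> ->]] := compose_id y; rewrite !ffunE eqxx mul1r mulr1.
move=> x /negPf xid; rewrite big1 // => y _.
by rewrite !ffunE xid !mul0r scale0r.
Qed.

Lemma palg_mul1r : right_id palg_one palg_mul.
Proof.
move=> a; rewrite /palg_mul -[RHS]palg_sum_basis; apply: eq_bigr => x _.
rewrite (bigD1 (id_diagram n)) //= [X in _ + X]big1 ?addr0.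
  by have [[-> ->] _] := compose_id x; rewrite !ffunE eqxx !mulr1.
by move=> y /negPf yid; rewrite !ffunE yid mulr0 mul0r scale0r.
Qed.

Lemma palg_one_neq0 : palg_one != 0.
Proof.
apply/eqP => /ffunP/(_ (id_diagram n)); rewrite !ffunE eqxx => /eqP.
by rewrite oner_eq0.
Qed.

HB.instance Definition _ := GRing.Zmodule_isNzRing.Build P
  palg_mulA palg_mul1l palg_mul1r palg_mulDl palg_mulDr palg_one_neq0.

Lemma palg_scaleAl (c : k) (a b : P) : c *: (a * b) = (c *: a) * b.
Proof.
rewrite [LHS]scaler_sumr; apply: eq_bigr => x _.
rewrite scaler_sumr; apply: eq_bigr => y _.
by rewrite ffunE scalerA !mulrA.
Qed.

Lemma palg_scaleAr (c : k) (a b : P) : c *: (a * b) = a * (c *: b).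
Proof.
rewrite [LHS]scaler_sumr; apply: eq_bigr => x _.
rewrite scaler_sumr; apply: eq_bigr => y _.
rewrite ffunE scalerA; congr (_ *: _); rewrite [_ *: _]/GRing.scale /=.
by move: (a x) (b y) (delta ^+ _) => r1 r2 r3; ring.
Qed.

HB.instance Definition _ := GRing.Lmodule_isLalgebra.Build k P palg_scaleAl.
HB.instance Definition _ := GRing.Lalgebra_isAlgebra.Build k P palg_scaleAr.

End PartitionAlgebra.

Section Cells.
Variables (n t : nat).
Implicit Types d x v : diagram n.

Definition propagating d : {set {set node n}} :=
  [set B in blocks d | [exists i, inl i \in B] && [exists j, inr j \in B]].

(* The diagrams that form the basis of V(n,t) *)
Definition cell_diagram d : bool :=
  (#|propagating d| == t) &&
  [forall j : 'I_n, (t <= j)%N ==> ([set inr j] \in blocks d)].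

Definition cell_basis : Type := {d : diagram n | cell_diagram d}.
HB.instance Definition _ := SubType.on cell_basis.
HB.instance Definition _ := Finite.on cell_basis.

(* Renames the southern node j as s j for j < t, for t <= n *)
Definition south_perm (s : 'S_t) (a : node n) : node n :=
  match a with
  | inl i => inl i
  | inr j => inr (if insub (val j) is Some i then insubd j (val (s i)) else j)
  end.

(* The southern node j of d becomes the southern node s j. As s * r is s
   followed by r, this is a right action. *)
Lemma act_right_partition d (s : 'S_t) :
  partition (preim_partition (fun a => pblock d (south_perm s^-1 a))
    [set: node n]) [set: node n].
Proof. exact: preim_partitionP. Qed.

Definition act_right d (s : 'S_t) : diagram n :=
  Diagram (act_right_partition d s).

Lemma same_act_right d s a b :
  same_block (act_right d s) a b = same_block d (south_perm s^-1 a) (south_perm s^-1 b).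
Proof. by rewrite same_preim same_blockE. Qed.

Lemma same_singleton d a : ([set a] \in blocks d) <-> (forall b, same_block d a b -> b = a).
Proof.
split=> [ad b|H].
  by case/same_blockP=> B Bd /andP[aB bB]; apply/set1P;
    rewrite -(def_pblock (diagram_trivIset d) ad (set11 a)) (def_pblock (diagram_trivIset d) Bd aB).
suff -> : [set a] = pblock d a by rewrite pblock_mem ?diagram_cover.
by apply/setP=> b; rewrite !inE; apply/eqP/idP=> [->|/H//]; rewrite mem_pblock diagram_cover.
Qed.

Lemma in_block d a b (B : {set node n}) : B \in blocks d -> a \in B -> (b \in B) = same_block d a b.
Proof. by move=> Bd aB; rewrite /same_block (def_pblock (diagram_trivIset d) Bd aB). Qed.

Lemma propagatingP d (B : {set node n}) :
  reflect (exists i j, [/\ B = pblock d (inl i), B = pblock d (inr j) & same_block d (inl i) (inr j)])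
    (B \in propagating d).
Proof.
rewrite inE; apply: (iffP and3P) => [[Bd /existsP[i iB] /existsP[j jB]]|[i [j [Bi Bj ij]]]].
  by exists i, j; rewrite -(in_block _ Bd iB) (def_pblock (diagram_trivIset d) Bd iB) (def_pblock (diagram_trivIset d) Bd jB).
split; first by rewrite Bi pblock_mem ?diagram_cover.
  by apply/existsP; exists i; rewrite Bi mem_pblock diagram_cover.
by apply/existsP; exists j; rewrite Bj mem_pblock diagram_cover.
Qed.

Lemma propagating_le_n d : (#|propagating d| <= n)%N.
Proof.
rewrite -[X in (_ <= X)%N]card_ord; apply: leq_trans (leq_imset_card (fun i => pblock d (inl i)) predT).
apply/subset_leq_card/subsetP=> B /propagatingP[i [j [-> _ _]]].
exact: imset_f.
Qed.

Lemma cell_diagram_le d : cell_diagram d -> (t <= n)%N.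
Proof. by case/andP=> /eqP <- _; apply: propagating_le_n. Qed.

Lemma propagating_compose x v : (#|propagating (compose x v)| <= #|propagating v|)%N.
Proof.
pose th (C : {set node n}) := if [pick j | inr j \in C] is Some j
   then pblock (compose x v) (inr j) else set0.
apply: leq_trans (leq_imset_card th _).
apply/subset_leq_card/subsetP=> B /propagatingP[i [j0 [_ Bj0 ij]]].
have low j j' : same_block v (inr j) (inr j') -> same_block (compose x v) (inr j) (inr j').
  by rewrite same_compose => /(glued_lower x).
have [j /andP[jB /existsP[m jm]]|no] := pickP [pred j | same_block (compose x v) (inr j0) (inr j) && [exists m, same_block v (inr j) (inl m)]].
  apply/imsetP; exists (pblock v (inr j)).
    apply/propagatingP; exists m, j; rewrite same_sym; split=> //.
    by apply/eqP; rewrite -same_blockE.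
  rewrite Bj0 /th; case: pickP => [j'|/(_ j)]; last by rewrite mem_pblock diagram_cover.
  rewrite -/(same_block _ _ _) => jj'; apply/eqP; rewrite -same_blockE.
  by rewrite (same_left jB) low.
have: exists2 j, inl (inl i) = inr j :> stack n & same_block (compose x v) (inr j0) (inr j).
  have con : connect (glued x v) (outer (inr j0)) (outer (inl i)).
    by rewrite -same_compose same_sym.
  apply: (glued_ind (Q := fun u => exists2 j, u = inr j & same_block (compose x v) (inr j0) (inr j))) con _.
  - by move=> a b _ [j].
  - move=> [a|a] b ab [j] //= [<-] ja.
    case: b ab => b ab; last by exists b => //; rewrite (same_left ja) low.
    by have := no a; rewrite /= ja /=; case/existsP; exists b.
  by exists j0; rewrite ?same_refl.
by case.
Qed.

Lemma singleton_compose x v j :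
  [set inr j] \in blocks v -> [set inr j] \in blocks (compose x v).
Proof.
move/same_singleton=> H; apply/same_singleton=> b; rewrite same_compose => con.
have : outer b = inr j.
  apply: (glued_ind (Q := fun u => u = inr j)) con _ => //.
  by move=> [a|a] b' ab //= [?]; subst a; have -> := H _ ab.
by case: b {con} => b //= [->].
Qed.

Lemma cell_compose x y v : cell_diagram v -> ~~ cell_diagram (compose y v) ->
  ~~ cell_diagram (compose x (compose y v)).
Proof.
case/andP=> /eqP pv /forallP sv; apply: contra => /andP[/eqP pxyv _].
have le1 := propagating_compose x (compose y v).
have le2 := propagating_compose y v.
apply/andP; split; first by rewrite eqn_leq -{1}pv le2 -pxyv le1.
by apply/forallP=> j; apply/implyP=> tj; apply: singleton_compose; apply: (implyP (sv j)).
Qed.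

Hypothesis tn : (t <= n)%N.

Lemma south_permK s : cancel (south_perm s) (south_perm s^-1).
Proof.
case=> //= j; congr inr; case: (insubP _ (val j)) => [i _ ij|jt] /=.
  have lt : (s i < n)%N by apply: leq_trans (ltn_ord _) tn.
  have -> : val (insubd j (val (s i))) = s i by rewrite val_insubd lt.
  by rewrite valK permK; apply: val_inj; rewrite val_insubd ij ltn_ord.
by rewrite insubN.
Qed.

Lemma south_permVK s : cancel (south_perm s^-1) (south_perm s).
Proof. by have := south_permK s^-1; rewrite invgK. Qed.

Lemma act_rightK s d : act_right (act_right d s) s^-1 = d.
Proof. by apply: diagram_ext => a b; rewrite !same_act_right invgK !south_permK. Qed.

Lemma south_permM s r a : south_perm (s * r)%g a = south_perm r (south_perm s a).
Proof.
case: a => //= j; congr inr; case: (insubP _ (val j)) => [i _ ij|jt] /=.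
  have lt : (s i < n)%N by apply: leq_trans (ltn_ord _) tn.
  have -> : val (insubd j (val (s i))) = s i by rewrite val_insubd lt.
  by rewrite valK permM; apply: val_inj; rewrite !val_insubd (leq_trans (ltn_ord _) tn).
by rewrite insubN.
Qed.

Lemma act_rightM d s r : act_right d (s * r)%g = act_right (act_right d s) r.
Proof.
by apply: diagram_ext => a b; rewrite !same_act_right invMg !south_permM.
Qed.

Lemma transfer_act_right d s f h :
  transfer (act_right d s) f h = transfer d f [ffun j => if south_perm s (inr j) is inr j' then h j' else false].
Proof.
set h' := [ffun j => _].
have jE a : join_colouring f h' a = join_colouring f h (south_perm s a) by case: a => //= i; rewrite ffunE.
rewrite /transfer; congr nat_of_bool; apply/block_constantP/block_constantP=> H a b ab.
  by rewrite !jE; apply: H; rewrite same_act_right !south_permK.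
by rewrite -[a](south_permVK s) -[b](south_permVK s) -!jE; apply: H; rewrite -same_act_right.
Qed.

Lemma compose_act_right x d s :
  loops x (act_right d s) = loops x d /\
  compose x (act_right d s) = act_right (compose x d) s.
Proof.
apply: transfer_inj => f h; rewrite -(transfer_mul x (act_right d s)) (transfer_act_right (compose x d)) -(transfer_mul x d).
by apply: eq_bigr => g _; rewrite transfer_act_right.
Qed.

Lemma propagating_act_right d s : (#|propagating (act_right d s)| <= #|propagating d|)%N.
Proof.
apply: leq_trans (leq_imset_card (fun C : {set node n} => south_perm s^-1 @^-1: C) _).
apply/subset_leq_card/subsetP=> B /propagatingP[i [j [Bi Bj ij]]].
apply/imsetP; exists (pblock d (inl i)).
  apply/propagatingP; rewrite same_act_right /= in ij.
  by eexists i, _; split; [|apply/eqP; rewrite -same_blockE; exact: ij|exact: ij].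
rewrite Bi; apply/setP=> b; rewrite inE -!/(same_block _ _ _).
exact: same_act_right.
Qed.

Lemma cell_act_right_sub d s : cell_diagram d -> cell_diagram (act_right d s).
Proof.
case/andP=> /eqP pd /forallP sd; apply/andP; split.
  rewrite eqn_leq -{1}pd propagating_act_right -pd -{1}(act_rightK s d).
  exact: propagating_act_right.
apply/forallP=> j; apply/implyP=> tj.
have /same_singleton H := implyP (sd j) tj.
have fixj r : south_perm r (inr j) = inr j by rewrite /= insubN // -leqNgt.
apply/same_singleton=> b; rewrite same_act_right fixj => /H e.
by rewrite -[b](south_permVK s) e fixj.
Qed.

Lemma cell_act_right d s : cell_diagram (act_right d s) = cell_diagram d.
Proof.
apply/idP/idP; last exact: cell_act_right_sub.
by move/(cell_act_right_sub s^-1); rewrite act_rightK.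
Qed.

End Cells.

(* V(n,t) (x)_k S, as functions from the basis of V(n,t) to S. On a diagram v of
   this basis, pure_tensor v s is the tensor v (x) s; it is 0 on all other diagrams, so
   that pure_tensor (compose x v) s is 0 if compose x v has fewer than t propagating
   blocks. *)
Definition free_cell_module (k : fieldType) (n t : nat) (delta : k)
  (S : vectType k) : Type := {ffun cell_basis n t -> S}.

Section CellModule.
Variables (k : fieldType) (n t : nat) (delta : k) (S : vectType k).
Variable rho : 'S_t -> 'End(S).
Local Notation P := (partition_algebra n delta).
Local Notation VS := {ffun cell_basis n t -> S}.
Local Notation E := (free_cell_module n t delta S).

HB.instance Definition _ := GRing.Zmodule.copy E VS.

Definition pure_tensor (d : diagram n) (s : S) : VS :=
  [ffun v => if val v == d then s else 0].

Definition cell_scale (a : P) (f : E) : E :=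
  \sum_(x : diagram n) \sum_(v : cell_basis n t)
    (a x * delta ^+ loops x (val v)) *: pure_tensor (compose x (val v)) (f v).

Lemma pure_tensor0 d : pure_tensor d 0 = 0.
Proof. by apply/ffunP=> v; rewrite !ffunE if_same. Qed.
Lemma pure_tensorD d : {morph pure_tensor d : s s' / s + s'}.
Proof. by move=> s s'; apply/ffunP=> v; rewrite !ffunE; case: eqP; rewrite ?addr0. Qed.
Lemma pure_tensorZ d c s : pure_tensor d (c *: s) = c *: pure_tensor d s.
Proof. by apply/ffunP=> v; rewrite !ffunE; case: eqP; rewrite ?scaler0. Qed.
Lemma pure_tensor_out d s : ~~ cell_diagram t d -> pure_tensor d s = 0.
Proof.
by move=> nd; apply/ffunP=> v; rewrite !ffunE; case: eqP => // vd; case/negP: nd; rewrite -vd (valP v).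
Qed.
Lemma pure_tensorE (f : VS) : \sum_v pure_tensor (val v) (f v) = f.
Proof.
apply/ffunP=> w; rewrite sum_ffunE (bigD1 w) //= !ffunE eqxx big1 ?addr0 // => v.
by rewrite ffunE (inj_eq val_inj) eq_sym => /negPf->.
Qed.

Lemma cell_scaleDr : right_distributive cell_scale +%R.
Proof.
move=> a f g; rewrite /cell_scale -big_split; apply: eq_bigr => x _ /=.
rewrite -big_split; apply: eq_bigr => v _ /=.
by rewrite ffunE pure_tensorD scalerDr.
Qed.

Lemma cell_scaleDl f : {morph cell_scale^~ f : a b / a + b}.
Proof.
move=> a b; rewrite /cell_scale -big_split; apply: eq_bigr => x _ /=.
rewrite -big_split; apply: eq_bigr => v _ /=.
by rewrite ffunE mulrDl scalerDl.
Qed.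

Lemma cell_scale0 a : cell_scale a 0 = 0.
Proof.
by rewrite /cell_scale big1 // => x _; rewrite big1 // => v _; rewrite ffunE pure_tensor0 scaler0.
Qed.

Lemma cell_scale_sum a I (r : seq I) (F : I -> VS) :
  cell_scale a (\sum_(i <- r) F i) = \sum_(i <- r) (cell_scale a (F i)).
Proof.
by elim/big_rec2: _ => [|i y z _ <-]; [apply: cell_scale0 | rewrite cell_scaleDr].
Qed.

Lemma cell_scaleZ a c (f : VS) : cell_scale a (c *: f : VS) = c *: (cell_scale a f : VS).
Proof.
rewrite /cell_scale scaler_sumr; apply: eq_bigr => x _.
rewrite scaler_sumr; apply: eq_bigr => v _.
by rewrite ffunE pure_tensorZ !scalerA mulrC.
Qed.

Lemma cell_scale_pureV a (v : cell_basis n t) s :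
  cell_scale a (pure_tensor (val v) s) =
  \sum_x (a x * delta ^+ loops x (val v)) *: pure_tensor (compose x (val v)) s.
Proof.
apply: eq_bigr => x _; rewrite (bigD1 v) //= ffunE eqxx.
rewrite [X in _ + X]big1 ?addr0 // => w /negPf wv.
by rewrite ffunE (inj_eq val_inj) wv pure_tensor0 scaler0.
Qed.

Lemma cell_scale_pure a d s : cell_diagram t d ->
  cell_scale a (pure_tensor d s) =
  \sum_x (a x * delta ^+ loops x d) *: pure_tensor (compose x d) s.
Proof. move=> dB; exact: (cell_scale_pureV a (exist _ d dB)). Qed.

Lemma cell_scaleA a b f : cell_scale a (cell_scale b f) = cell_scale (a * b) f.
Proof.
rewrite -(pure_tensorE f) !cell_scale_sum; apply: eq_bigr => v _.
rewrite !cell_scale_pure ?(valP v) // cell_scale_sum.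
have vB := valP v; move: (f v) (val v) vB => s d dB.
transitivity (\sum_x (a * b) x *: (delta ^+ loops x d *: pure_tensor (compose x d) s));
  last by apply: eq_bigr => x _; rewrite scalerA.
rewrite [RHS](palg_mul_sum a b) [RHS]exchange_big; apply: eq_bigr => y _.
rewrite cell_scaleZ; have [yd|nyd] := boolP (cell_diagram t (compose y d)).
  rewrite cell_scale_pure // scaler_sumr; apply: eq_bigr => x _.
  have [e <-] := compose_assoc x y d; rewrite !scalerA; congr (_ *: _).
  rewrite -[RHS]mulrA -exprD -e exprD.
  move: (a x) (b y) (delta ^+ _) (delta ^+ _) => r1 r2 r3 r4; ring.
rewrite pure_tensor_out // cell_scale0 scaler0.
rewrite big1 // => x _; have [_ <-] := compose_assoc x y d.
by rewrite pure_tensor_out ?scaler0 // cell_compose.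
Qed.

Lemma cell_scale1 : left_id 1 cell_scale.
Proof.
move=> f; rewrite -[RHS]pure_tensorE -[X in cell_scale _ X](pure_tensorE f) cell_scale_sum.
apply: eq_bigr => v _; rewrite cell_scale_pure ?(valP v) //.
rewrite (bigD1 (id_diagram n)) //= big1 ?addr0.
  by have [_ [-> ->]] := compose_id (val v); rewrite !ffunE eqxx mul1r scale1r.
by move=> x /negPf xid; rewrite !ffunE xid mul0r scale0r.
Qed.

HB.instance Definition _ := GRing.Zmodule_isLmodule.Build P E
  cell_scaleA cell_scale1 cell_scaleDr cell_scaleDl.

(* The k-span of the elements (v sg) (x) s - v (x) (sg s) *)
Definition balanced (f : E) : Prop :=
  exists s : cell_basis n t -> 'S_t -> S,
    f = \sum_v \sum_sg
          (pure_tensor (act_right (val v) sg) (s v sg) - pure_tensor (val v) (rho sg (s v sg))).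

Lemma balanced0 : balanced 0.
Proof.
exists (fun _ _ => 0); rewrite big1 // => v _; rewrite big1 // => sg _.
by rewrite linear0 !pure_tensor0 subr0.
Qed.

Lemma pure_tensorB d s s' : pure_tensor d (s - s') = pure_tensor d s - pure_tensor d s'.
Proof. by rewrite pure_tensorD -scaleN1r pure_tensorZ scaleN1r. Qed.

Lemma balancedD f g : balanced f -> balanced g -> balanced (f + g).
Proof.
case=> s -> [s' ->]; exists (fun v sg => s v sg + s' v sg).
rewrite -big_split; apply: eq_bigr => v _ /=.
rewrite -big_split; apply: eq_bigr => sg _ /=.
by rewrite linearD !pure_tensorD opprD addrACA.
Qed.

Lemma balancedZ c (f : VS) : balanced f -> balanced (c *: f : VS).
Proof.
case=> s ->; exists (fun v sg => c *: s v sg).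
rewrite scaler_sumr; apply: eq_bigr => v _ /=.
rewrite scaler_sumr; apply: eq_bigr => sg _ /=.
by rewrite linearZ !pure_tensorZ scalerBr.
Qed.

Lemma balancedBZ c (f g : VS) :
  balanced (f - g : VS) -> balanced (c *: f - c *: g : VS).
Proof. by rewrite -scalerBr; apply: balancedZ. Qed.

Lemma balanced_sum I (r : seq I) (F : I -> VS) :
  (forall i, balanced (F i)) -> balanced (\sum_(i <- r) F i).
Proof.
by move=> H; elim/big_rec: _ => [|i y _]; [apply: balanced0 | apply: balancedD].
Qed.

Lemma balanced_gen d sg s :
  balanced (pure_tensor (act_right d sg) s - pure_tensor d (rho sg s)).
Proof.
have [dB|nd] := boolP (cell_diagram t d); last first.
  rewrite !pure_tensor_out ?subr0 //; first exact: balanced0.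
  apply: contra nd => dB.
  by rewrite -(cell_act_right (cell_diagram_le dB) d sg).
pose v : cell_basis n t := exist _ d dB.
exists (fun w r => if (w == v) && (r == sg) then s else 0).
rewrite (bigD1 v isT) /= [X in _ = _ + X]big1 ?addr0.
  rewrite (bigD1 sg isT) /= !eqxx [X in _ = _ + X]big1 ?addr0 // => r /negPf->.
  by rewrite andbF linear0 !pure_tensor0 subr0.
move=> w /negPf->; rewrite big1 // => r _.
by rewrite linear0 !pure_tensor0 subr0.
Qed.

Lemma balanced_scale a f : balanced f -> balanced (cell_scale a f).
Proof.
case=> s ->; rewrite cell_scale_sum; apply: balanced_sum => v.
rewrite cell_scale_sum; apply: balanced_sum => sg.
have dB := valP v; have tn := cell_diagram_le dB.
rewrite -scaleN1r cell_scaleDr cell_scaleZ scaleN1r.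
rewrite !cell_scale_pure ?cell_act_right // -sumrB.
apply: balanced_sum => x; have [-> ->] := compose_act_right tn x (val v) sg.
exact/balancedBZ/balanced_gen.
Qed.

Lemma balanced_closed : @submod_closed P E [pred f : E | `[< balanced f >]].
Proof.
split=> [|a f g]; rewrite !inE; first exact/asboolP/balanced0.
move=> /asboolP fB /asboolP gB; apply/asboolP/balancedD => //.
exact: balanced_scale.
Qed.

Definition balanced_submodule : submodule E := Submodule balanced_closed.

(* V(n,t) (x)_(S_t) S *)
Definition tensor_module : lmodType P := quotient_module balanced_submodule.

End CellModule.

Section Specht.
Variables (k : fieldType) (la : seq nat).
Local Notation t := (sumn la).

(* The cells of the diagram of la are numbered from 0 row by row, and a tableau T
   is the permutation sending a cell to its entry. A row-equivalence class is
   given by the row of each entry; the functions from entries to rows with the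
   wrong row sizes are not tabloids, but do not occur in Specht modules. *)
Definition row_of (i : 'I_t) : 'I_(size la) := Ordinal (reshape_indexP (ltn_ord i)).
Definition col_of (i : 'I_t) : nat := reshape_offset la i.

Local Notation tabloid := {ffun 'I_t -> 'I_(size la)}.
Local Notation permutation_module := {ffun tabloid -> k^o}.

Definition tabloid_of (T : 'S_t) : tabloid := [ffun a => row_of (T^-1%g a)].

Definition tabloid_vec (T : tabloid) : permutation_module := [ffun T' => (T' == T)%:R].

Definition column_stabilizer (T : 'S_t) : {set 'S_t} :=
  [set s : 'S_t | [forall a, col_of (T^-1%g (s a)) == col_of (T^-1%g a)]].

Definition polytabloid (T : 'S_t) : permutation_module :=
  \sum_(s in column_stabilizer T) (-1) ^+ s *: tabloid_vec (tabloid_of (T * s)%g).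

Definition specht : {vspace permutation_module} :=
  <<[seq polytabloid T | T : 'S_t]>>%VS.

(* The left action of the symmetric group: s sends the class of T to that of
   T * s^-1, since s * r is s followed by r. *)
Definition permute (s : 'S_t) (f : permutation_module) : permutation_module :=
  [ffun T : tabloid => f [ffun a => T (s^-1%g a)]].

Lemma permute_is_linear s : linear (permute s).
Proof. by move=> c f g; apply/ffunP=> T; rewrite !ffunE. Qed.
HB.instance Definition _ s := GRing.isLinear.Build k permutation_module permutation_module
  _ (permute s) (permute_is_linear s).

Lemma permute_tabloid s T : permute s (tabloid_vec (tabloid_of T)) = tabloid_vec (tabloid_of (T * s^-1)%g).
Proof.
apply/ffunP=> T'; rewrite !ffunE; congr (_ %:R); congr nat_of_bool.
apply/eqP/eqP=> [/ffunP H|->]; apply/ffunP=> a.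
  have := H (s a); rewrite !ffunE permK => ->.
  by rewrite invMg invgK permM.
by rewrite !ffunE invMg invgK permM permKV.
Qed.

Lemma permuteM s r f : permute (s * r)%g f = permute s (permute r f).
Proof.
apply/ffunP=> T; rewrite !ffunE; congr (f _); apply/ffunP=> a.
by rewrite !ffunE invMg permM.
Qed.

Lemma permute_polytabloid s T : permute s (polytabloid T) = polytabloid (T * s^-1)%g.
Proof.
rewrite /polytabloid linear_sum /= [RHS](reindex_inj (conjg_inj s^-1%g)) /=.
apply: eq_big => r.
  rewrite !inE; apply/forallP/forallP=> H a.
    by have := H (s a); rewrite conjgE !invMg !invgK !permM permKV.
  by have := H (s^-1%g a); rewrite conjgE !invMg !invgK !permM !permKV.
move=> _; rewrite linearZ /= permute_tabloid odd_permJ conjgE invgK.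
by rewrite !mulgA mulgKV.
Qed.

Lemma permute_specht s f : f \in specht -> permute s f \in specht.
Proof.
have sub : (linfun (permute s) @: specht <= specht)%VS.
  rewrite limg_span; apply/span_subvP=> _ /mapP[_ /mapP[T _ ->] ->].
  rewrite lfunE /= permute_polytabloid; apply: memv_span.
  by apply/mapP; exists (T * s^-1)%g; rewrite ?mem_enum.
by move=> fS; apply: (subvP sub); rewrite -[permute s f](lfunE (permute s)) memv_img.
Qed.

Definition specht_action (s : 'S_t) : 'End(subvs_of specht) :=
  linfun (vsproj specht \o permute s \o vsval).

Lemma specht_actionE s u : vsval (specht_action s u) = permute s (vsval u).
Proof. by rewrite lfunE /= vsprojK // permute_specht // subvsP. Qed.

Lemma specht_actionM s r u :
  specht_action (s * r)%g u = specht_action s (specht_action r u).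
Proof. by apply: subvs_inj; rewrite !specht_actionE permuteM. Qed.

End Specht.

Definition cell_module (k : fieldType) (n : nat) (delta : k) (la : seq nat) :
    lmodType (partition_algebra n delta) :=
  tensor_module n delta (@specht_action k la).

(* L_la, when delta is nonzero and la is p-regular *)
Definition simple_head (k : fieldType) (n : nat) (delta : k)
    (la : seq nat) : lmodType (partition_algebra n delta) :=
  module_head (cell_module n delta la).

(* Main.v *)
Require Import Defs.
From HB Require Import structures.
From mathcomp Require Import all_boot all_order all_fingroup all_algebra.
From mathcomp Require Import pgroup boolp generic_quotient.

(** Here n = p, and delta = p - 1 is the non-zero element -1 of k.

    For a partition la of p, the basis of the cell module consists of the
    permutation diagrams, so the cell module is the Specht module S^la of 'S_p,
    on which every diagram that is not a permutation acts by 0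
    (tensor_module_full, specht_model). The theorem thus has two parts: the
    composition factors of the hook Specht modules S_m = S^(p-m,1^m) in
    characteristic p, and the distinction of those factors from all the other
    modules L_la.

    Hooks. The tabloids of shape (p-m,1^m) are the m-tuples of distinct entries,
    so that S_m becomes a space of alternating functions of m arguments
    (flatten_specht): it is the m-th exterior power of the kernel of the
    augmentation k^p -> k, spanned by the boundaries hook_vec of the simplices on
    m + 1 points. Let sigma be the sum of the basis vectors of k^p; as p = 0 in k,
    it lies in the kernel of the augmentation, and the exterior product with sigma
    maps S_m to S_(m+1) (wedge_hook_vec). Contraction with one point is a
    contracting homotopy of the resulting complex (wedge_contract), which is
    therefore exact. Moreover antisymmetrising u in S_m over m + 1 points I gives
    m! (sigma ^ u)(I) times the generator of S_m attached to I (antisymmetrizeE).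
    So a submodule of S_m on which the product with sigma does not vanish is all of
    S_m (hook_generates): for m <= p - 2 the kernel of this product is the unique
    maximal submodule. By exactness it is the image of S_(m-1), that is, the head of
    S_(m-1), which gives the two composition factors. At the ends of the complex,
    S_0 embeds into S_1, and the head of S_(p-2) is all of S_(p-1).

    Distinct heads. Let L_la be isomorphic to the head of S_m, where m <= p - 2.
    If la is a partition of a number t < p, the cell module of la is generated by
    the action of diagrams with t < p propagating blocks, because delta is
    invertible; such diagrams kill S_m (cell_module_annihilated). If la is a
    partition of p, it is not (1^p), being p-regular, so its column stabilizer C
    has order prime to p, and the signed sum over C multiplies the generator of
    S^la by an invertible scalar (column_group_generates). This signed sum kills
    S_m when la has fewer than p - m columns, because then two of the p - m
    entries in the first row of a tabloid lie in one column of la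
    (column_group_kills). Symmetrically, the signed sum over a leg of m + 1
    entries kills S^la when la has fewer than m + 1 rows (leg_group_kills), but
    does not send S_m into its radical. Hence la has at least p - m columns and m
    + 1 rows, and the only partition of p with this property is (p-m,1^m). *)

Set Implicit Arguments.
Unset Strict Implicit.
Unset Printing Implicit Defensive.
Import GRing.Theory.
Local Open Scope ring_scope.

(** * Modules with a unique maximal submodule *)

Section ModuleTheory.
Variable A : nzRingType.
Implicit Types M N Q : lmodType A.

Lemma linear_map_exists M N (h : M -> N) : linear h -> exists f : {linear M -> N}, f =1 h.
Proof.
move=> hlin.
pose f : {linear M -> N} := HB.pack h (@GRing.isLinear.Build A M N *:%R h hlin).
by exists f.
Qed.

Lemma isomorphic_sym M N : isomorphic M N -> isomorphic N M.
Proof.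
case=> f [g fK gK].
have [h hE] : exists h : {linear N -> M}, h =1 g.
  apply: linear_map_exists => a x y; apply: (can_inj fK).
  by rewrite linearP /= !gK.
by exists h; exists f => x; rewrite hE.
Qed.

Lemma isomorphic_trans M N Q : isomorphic M N -> isomorphic N Q -> isomorphic M Q.
Proof.
case=> f bf [g bg]; exists (g \o f)%FUN; exact: bij_comp bg bf.
Qed.

(** The first isomorphism theorem, in a form that avoids forming the image of
    either map. *)
Lemma isomorphic_of_surj M N Q (f : {linear M -> N}) (g : {linear M -> Q}) :
  (forall y, exists x, f x = y) -> (forall y, exists x, g x = y) ->
  (forall x, f x = 0 <-> g x = 0) -> isomorphic N Q.
Proof.
move=> fsurj gsurj ker_fg.
have eqfg x y : f x = f y <-> g x = g y.
  have [fg gf] := ker_fg (x - y); rewrite !linearB /= in fg gf.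
  by split=> e; apply/eqP; rewrite -subr_eq0; apply/eqP; [apply: fg|apply: gf];
     rewrite e subrr.
pose s y := sval (cid (fsurj y)).
have fs y : f (s y) = y by exact: svalP (cid (fsurj y)).
have [h hE] : exists h : {linear N -> Q}, h =1 g \o s.
  apply: linear_map_exists => a x y /=.
  by rewrite -linearP; apply/eqfg; rewrite linearP !fs.
exists h; pose r z := f (sval (cid (gsurj z))).
exists r => [y|z]; rewrite ?hE /r /=.
  rewrite -[RHS]fs; apply/eqfg; exact: svalP (cid (gsurj _)).
rewrite -[RHS](svalP (cid (gsurj z))); apply/eqfg; exact: fs.
Qed.

Lemma submodZD M (U : submodule M) a x y : x \in U -> y \in U -> a *: x + y \in U.
Proof. by move=> xU yU; case: (submod_memP U) => _ /(_ a x y xU yU). Qed.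

Lemma submod0 M (U : submodule M) : 0 \in U.
Proof. by case: (submod_memP U). Qed.

Lemma submodZ M (U : submodule M) a x : x \in U -> a *: x \in U.
Proof. by move=> xU; rewrite -[_ *: _]addr0 submodZD // submod0. Qed.

Lemma zero_closed M : submod_closed (pred1 (0 : M)).
Proof.
split=> [|a x y]; rewrite !inE // => /eqP-> /eqP->.
by rewrite scaler0 addr0.
Qed.
Definition zero_submodule M := Submodule (@zero_closed M).

Lemma preimage_closed M N (f : {linear M -> N}) (U : submodule N) :
  submod_closed [pred x : M | f x \in U].
Proof.
by split=> [|a x y]; rewrite !inE ?linear0 ?submod0 // linearP; apply: submodZD.
Qed.
Definition preimage_submodule M N (f : {linear M -> N}) U := Submodule (preimage_closed f U).

Definition kernel M N (f : {linear M -> N}) := preimage_submodule f (zero_submodule N).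

Lemma in_kernel M N (f : {linear M -> N}) x : (x \in kernel f) = (f x == 0).
Proof. by []. Qed.

Lemma simple_module_iso M N : isomorphic M N -> simple_module M -> simple_module N.
Proof.
case=> f [g fK gK] [[x x0] sM]; split.
  by exists (f x); apply: contraNneq x0 => fx0; rewrite -(fK x) fx0 -(linear0 f) fK.
move=> U; case: (sM (preimage_submodule f U)) => H; [left|right] => y.
  have := H (g y); rewrite !inE /= gK => ->.
  apply/eqP/eqP => [gy0|->]; first by rewrite -(gK y) gy0 linear0.
  by rewrite -(linear0 f) fK.
by have := H (g y); rewrite !inE /= gK.
Qed.

Lemma full_closed M : submod_closed (@predT M).
Proof. by []. Qed.
Definition full_submodule M := Submodule (@full_closed M).

Lemma quotient_map M (U : submodule M) : exists q : {linear M -> quotient_module U},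
  (forall y, exists x, q x = y) /\ forall x, q x = 0 <-> x \in U.
Proof.
have [q qE] : exists q : {linear M -> quotient_module U}, q =1 \pi_(quotient_module U)%qT.
  apply: linear_map_exists => a x y; rewrite pi_addq.
  by rewrite pi_scale.
exists q; split=> [y|x]; first by exists (repr y); rewrite qE reprK.
rewrite qE; have <- : \pi_(quotient_module U)%qT 0 = 0 :> quotient_module U.
  by rewrite -qE linear0.
split=> [/eqP|xU]; first by rewrite -Quotient.idealrBE subr0.
by apply/eqP; rewrite -Quotient.idealrBE subr0.
Qed.

Section UniqueMaximal.
Variables (M : lmodType A) (K : submodule M).
Hypothesis K_proper : ~ (K =i predT).
Hypothesis K_max : forall U : submodule M, U =i predT \/ {subset U <= K}.

Lemma radical_unique_max : radical M =i K.
Proof.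
have maxK : maximal_submodule K.
  split=> // V KV; have [fV|VK] := K_max V; first by right.
  by left=> x; apply/idP/idP; [apply: VK | apply: KV].
move=> x; rewrite inE; apply/asboolP/idP => [H|xK U [Uproper maxU]]; first exact: H.
have [//|UK] := K_max U.
by case: (maxU K UK) => // H; rewrite -H.
Qed.

Lemma simple_of_unique_max N (f : {linear M -> N}) :
  (forall y, exists x, f x = y) -> (forall x, f x = 0 <-> x \in K) -> simple_module N.
Proof.
move=> fsurj kerf; split.
  have [x xK] : exists x, x \notin K.
    apply: contrapT => no; apply: K_proper => x; rewrite [RHS]inE.
    by apply: contrapT => /negP xK; apply: no; exists x.
  by exists (f x); apply: contra xK => /eqP/kerf.
move=> U; have [H|H] := K_max (preimage_submodule f U); [right|left] => y; have [x <-] := fsurj y.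
  exact: H x.
apply/idP/eqP => [fU|->]; last exact: submod0.
by apply/kerf/H.
Qed.

Lemma simple_module_head : simple_module (module_head M).
Proof.
have [q [qsurj kerq]] := quotient_map (radical M).
apply: (simple_of_unique_max qsurj) => x.
by rewrite kerq radical_unique_max.
Qed.

End UniqueMaximal.

(** A layer U / V of M is identified with the head of N by a map from N onto U
    whose composite with U -> U / V has the radical of N as kernel. *)
Lemma subquotient_iso_head M N (U V : submodule M) (f : {linear N -> M}) :
  (forall y, y \in U <-> exists x, f x = y) -> (forall x, f x \in V <-> x \in radical N) ->
  isomorphic (subquotient U V) (module_head N).
Proof.
move=> imf kerf.
have fU x : f x \in submod_mem U by apply/imf; exists x.
have [g gE] : exists g : {linear N -> submod_type U}, forall x, val (g x) = f x.
  have [|g gE] := @linear_map_exists N (submod_type U) (fun x => Sub (f x) (fU x)).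
    by move=> a x y; apply: val_inj; rewrite /= linearP.
  by exists g => x; rewrite gE.
have [q [qsurj kerq]] := quotient_map (Submodule (restrict_closed U V)).
have [r [rsurj kerr]] := quotient_map (radical N).
apply: (@isomorphic_of_surj N _ _ (q \o g)%FUN r) => [y||x] //.
  have [u <-] := qsurj y; have /imf[x fx] : val u \in U by exact: valP u.
  by exists x => /=; congr (q _); apply: val_inj; rewrite gE.
by rewrite kerr -kerf /=; split=> [/kerq|H]; [|apply/kerq]; rewrite inE /= gE.
Qed.

(** The heads of modules are told apart by the elements of the algebra that
    kill one of the modules. *)
Lemma head_kills M N a : isomorphic (module_head M) (module_head N) ->
  (forall x : M, a *: x = 0) -> forall x : N, a *: x \in radical N.
Proof.
case=> f [g _ gK] aM x.
have [q [qsurj _]] := quotient_map (radical M).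
have [r [_ kerr]] := quotient_map (radical N).
apply/kerr; rewrite linearZ /= -(gK (r x)); have [y <-] := qsurj (g (r x)).
by rewrite -!linearZ /= aM !linear0.
Qed.

Lemma composition_multiplicity_two M (V : submodule M) (Q1 Q2 L : lmodType A) :
  simple_module Q1 -> simple_module Q2 ->
  isomorphic (subquotient V (zero_submodule M)) Q1 ->
  isomorphic (subquotient (full_submodule M) V) Q2 ->
  composition_multiplicity M L (`[< isomorphic Q1 L >] + `[< isomorphic Q2 L >])%N.
Proof.
move=> s1 s2 i1 i2.
pose U i := if i is i'.+1 then if i' is 0 then V else full_submodule M else zero_submodule M.
exists 2%N, U; split.
  split=> // [] [|[|//]] _; split=> //.
  - by move=> x; rewrite inE => /eqP->; apply: submod0.
  - exact: simple_module_iso (isomorphic_sym i1) s1.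
  - exact: simple_module_iso (isomorphic_sym i2) s2.
rewrite -sum1_card big_mkcond big_ord_recl big_ord1 !inE /=.
have isoE Q Q' : isomorphic Q Q' -> `[< isomorphic Q L >] = `[< isomorphic Q' L >].
  move=> QQ'; apply: asbool_equiv_eq; split; apply: isomorphic_trans => //.
  exact: isomorphic_sym.
by rewrite (isoE _ _ i1) (isoE _ _ i2); case: `[< _ >]; case: `[< _ >].
Qed.

End ModuleTheory.

(** * Cell modules of full size are inflated from the symmetric group *)

Section PermutationDiagrams.
Variable n : nat.

Definition perm_diagram (s : 'S_n) : diagram n := act_right (id_diagram n) s.

Lemma same_id_diagram (i j : 'I_n) : same_block (id_diagram n) (inl i) (inr j) = (i == j).
Proof. by rewrite /id_diagram same_preim. Qed.

Lemma south_perm_inr (s : 'S_n) (j : 'I_n) : south_perm s (inr j) = inr (s j).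
Proof. by congr inr; rewrite /= valK; apply: val_inj; rewrite val_insubd ltn_ord. Qed.

Lemma same_perm_diagram (s : 'S_n) i j :
  same_block (perm_diagram s) (inl i) (inr j) = (s i == j).
Proof.
rewrite same_act_right south_perm_inr same_id_diagram.
by rewrite (canF_eq (permK s)).
Qed.

Lemma perm_diagram_inj : injective perm_diagram.
Proof.
move=> s r e; apply/permP=> i; apply/eqP; rewrite -(same_perm_diagram s) e.
by rewrite same_perm_diagram.
Qed.

(** With n propagating blocks, the map from northern nodes to blocks is
    injective and reaches every propagating block, so each northern node is joined
    to some southern one; injectivity makes this correspondence a permutation,
    and all remaining southern nodes are used up. *)
Lemma cell_diagram_full (d : diagram n) :
  cell_diagram n d <-> exists s, d = perm_diagram s.
Proof.
split=> [/andP[/eqP pd _]|[s ->]]; last first.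
  rewrite /perm_diagram cell_act_right //; apply/andP; split; last first.
    by apply/forallP=> j; rewrite leqNgt ltn_ord.
  rewrite eqn_leq propagating_le_n /= -[leqLHS]card_ord.
  rewrite -(card_imset (f := fun i => pblock (id_diagram n) (inl i)) predT).
    apply/subset_leq_card/subsetP=> _ /imsetP[i _ ->].
    apply/propagatingP; exists i, i; split=> //.
      by apply/eqP; rewrite -same_blockE same_id_diagram.
    by rewrite same_id_diagram.
  move=> i j /eqP; rewrite -same_blockE /id_diagram same_preim.
  by move/eqP.
pose f i := pblock d (inl i).
have sub : propagating d \subset f @: [set: 'I_n].
  by apply/subsetP=> B /propagatingP[i [j [-> _ _]]]; apply: imset_f.
have cf : #|f @: [set: 'I_n]| = #|[set: 'I_n]|.
  apply/eqP; rewrite eqn_leq leq_imset_card /= cardsT card_ord.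
  by rewrite -[leqLHS]pd subset_leq_card.
have finj : injective f.
  by move=> i j fij; move/eqP/imset_injP: cf => cf; apply: cf; rewrite ?inE.
have /eqP fE : propagating d == f @: [set: 'I_n].
  by rewrite eqEcard sub cf cardsT card_ord pd leqnn.
have ex i : exists j, same_block d (inl i) (inr j).
  have : f i \in propagating d by rewrite fE imset_f.
  case/propagatingP=> i' [j [e _ ij]]; exists j.
  by move: ij; rewrite !same_blockE -e.
have [r rE] := fin_all_exists ex.
have rinj : injective r.
  move=> i j e; apply: finj; have := rE i; rewrite e => ij.
  by apply/eqP; rewrite -same_blockE (same_left ij) same_sym.
exists (perm rinj); apply: diagram_ext.
have toN (e : diagram n) a : (forall i, same_block e (inl i) (inr (r i))) ->
    same_block e a =1 same_block e (inl (match a with inl i => i | inr j => (perm rinj)^-1%g j end)).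
  move=> H; case: a => // j; apply: same_left; rewrite same_sym.
  by have := H ((perm rinj)^-1%g j); rewrite -[in r _](permE rinj) permKV.
have dE a b : same_block d a b =
    ((match a with inl i => i | inr j => (perm rinj)^-1%g j end)
     == (match b with inl i => i | inr j => (perm rinj)^-1%g j end)).
  rewrite (toN d) // same_sym (toN d) // same_blockE; apply/eqP/eqP=> [/finj//|->//].
move=> a b; rewrite dE.
have rP i : same_block (perm_diagram (perm rinj)) (inl i) (inr (r i)).
  by rewrite same_perm_diagram permE.
rewrite (toN _ a rP) same_sym (toN _ b rP) same_act_right /id_diagram same_preim /=.
by rewrite eq_sym.
Qed.

Lemma compose_perm_diagram (x : diagram n) s :
  loops x (perm_diagram s) = 0 /\ compose x (perm_diagram s) = act_right x s.
Proof.
have [l c] := compose_act_right (leqnn n) x (id_diagram n) s.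
by have [[l0 c0] _] := compose_id x; rewrite l c l0 c0.
Qed.

End PermutationDiagrams.

Section Inflation.
Variables (k : fieldType) (n : nat) (delta : k).
Local Notation P := (partition_algebra n delta).

(** The action of a in the partition algebra through its quotient, the group
    algebra of 'S_n. *)
Definition act_sum (W : lmodType k) (act : 'S_n -> W -> W) (a : P) (w : W) : W :=
  \sum_s a (perm_diagram s) *: act s w.

Variables (S : vectType k) (rho : 'S_n -> 'End(S)).
Hypothesis rho1 : forall x, rho 1%g x = x.
Hypothesis rhoM : forall s r x, rho (s * r)%g x = rho s (rho r x).
Local Notation VS := {ffun cell_basis n n -> S}.

Let ev (f : VS) : S := \sum_s \sum_v (if val v == perm_diagram s then rho s (f v) else 0).

Let evD : {morph ev : f g / f + g}.
Proof.
move=> f g; rewrite /ev -big_split; apply: eq_bigr => s _ /=.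
rewrite -big_split; apply: eq_bigr => v _ /=.
by rewrite ffunE linearD; case: ifP; rewrite ?addr0.
Qed.

Let evZ c f : ev (c *: f) = c *: ev f.
Proof.
rewrite /ev scaler_sumr; apply: eq_bigr => s _; rewrite scaler_sumr.
by apply: eq_bigr => v _; rewrite ffunE linearZ; case: ifP; rewrite ?scaler0.
Qed.

Let ev0 : ev 0 = 0. Proof. by rewrite -(scale0r 0) evZ scale0r. Qed.

Let evB f g : ev (f - g) = ev f - ev g.
Proof. by rewrite evD -scaleN1r evZ scaleN1r. Qed.

Let ev_sum I (r : seq I) (F : I -> VS) : ev (\sum_(i <- r) F i) = \sum_(i <- r) ev (F i).
Proof. exact: (big_morph ev evD ev0). Qed.

Let ev_pure s x : ev (pure_tensor n (perm_diagram s) x) = rho s x.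
Proof.
have sB : cell_diagram n (perm_diagram s) by apply/cell_diagram_full; exists s.
pose w : cell_basis n n := exist _ (perm_diagram s) sB.
rewrite /ev (bigD1 s) //= (bigD1 w) //= eqxx ffunE eqxx.
rewrite big1 ?addr0 => [|v /negPf vw]; last first.
  case: ifP => // /eqP e; case/eqP: vw; exact: val_inj.
rewrite big1 ?addr0 // => r /negPf rs; rewrite big1 // => v _.
case: ifP => // /eqP e; rewrite ffunE; case: eqP => [e'|_].
  by move: rs; rewrite (perm_diagram_inj (etrans (esym e) e')) eqxx.
by rewrite linear0.
Qed.

Let ev_act d s x : ev (pure_tensor n (act_right d s) x) = ev (pure_tensor n d (rho s x)).
Proof.
have [/cell_diagram_full[r ->]|nd] := boolP (cell_diagram n d).
  by rewrite /perm_diagram -act_rightM // !ev_pure rhoM.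
by rewrite !pure_tensor_out // cell_act_right.
Qed.

Let ev_balanced f : @balanced k n n delta S rho f -> ev f = 0.
Proof.
case=> s ->; rewrite ev_sum big1 // => v _; rewrite ev_sum big1 // => r _.
by rewrite evB ev_act subrr.
Qed.

Let balanced_ev f : @balanced k n n delta S rho (f - pure_tensor n (id_diagram n) (ev f)).
Proof.
rewrite -[X in X - _]pure_tensorE -[X in ev X]pure_tensorE ev_sum.
rewrite (big_morph _ (pure_tensorD n (id_diagram n)) (pure_tensor0 n _ _)) -sumrB.
apply: balanced_sum => v; have /cell_diagram_full[s ->] := valP v.
by rewrite ev_pure; apply: balanced_gen.
Qed.

Let ev_scale a f : ev (cell_scale (a : P) f) = act_sum (fun s x => rho s x) a (ev f).
Proof.
have act_sumD x y : act_sum (fun s x => rho s x) a (x + y) =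
    act_sum (fun s x => rho s x) a x + act_sum (fun s x => rho s x) a y.
  by rewrite /act_sum -big_split; apply: eq_bigr => s _; rewrite linearD scalerDr.
have act_sum0 : act_sum (fun s x => rho s x) a 0 = 0.
  by rewrite /act_sum big1 // => s _; rewrite linear0 scaler0.
rewrite -[in LHS](pure_tensorE f) -[in RHS](pure_tensorE f) cell_scale_sum !ev_sum.
rewrite (big_morph _ act_sumD act_sum0); apply: eq_bigr => v _.
rewrite cell_scale_pure ?(valP v) //; have /cell_diagram_full[s ->] := valP v.
rewrite ev_pure ev_sum; set y := rho s _.
transitivity (\sum_x ev (a x *: pure_tensor n x y)).
  apply: eq_bigr => x _; have [-> ->] := compose_perm_diagram x s.
  by rewrite expr0 mulr1 !evZ ev_act.
rewrite (bigID (fun x => cell_diagram n x)) /= [X in _ + X]big1 ?addr0 => [|x nx]; last first.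
  by rewrite pure_tensor_out // scaler0 ev0.
have -> : \sum_(x | cell_diagram n x) ev (a x *: pure_tensor n x y) =
   \sum_(x in (@perm_diagram n) @: [set: 'S_n]) ev (a x *: pure_tensor n x y).
  apply: eq_bigl => x; apply/idP/imsetP=> [/cell_diagram_full[r ->]|[r _ ->]].
    by exists r.
  by apply/cell_diagram_full; exists r.
rewrite big_imset /=; last by move=> ? ? _ _; apply: perm_diagram_inj.
rewrite big_set /=; apply: eq_bigr => r _; by rewrite evZ ev_pure.
Qed.

(** The isomorphism V(n,n) (x) S -> S sends the permutation diagram of s tensored
    with x to the image of x under s. It kills the balanced elements, and each
    tensor is congruent to one on the identity diagram. *)
Lemma tensor_module_full : exists out : tensor_module n delta rho -> S,
  [/\ {morph out : x y / x + y}, injective out, forall y, exists x, out x = y &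
      forall a x, out (a *: x) = act_sum (fun s x => rho s x) a (out x)].
Proof.
have [q [qsurj kerq]] := quotient_map (balanced_submodule n delta rho).
have eq_ev f g : q f = q g <-> ev f = ev g.
  have H : q (f - g) = 0 <-> ev (f - g) = 0.
    rewrite kerq; split=> [/asboolP/ev_balanced//|e]; apply/asboolP.
    by have := balanced_ev (f - g); rewrite e pure_tensor0 subr0.
  rewrite linearB evB in H; split=> e; apply/eqP; rewrite -subr_eq0; apply/eqP.
    by apply/H; rewrite e subrr.
  by apply/H; rewrite e subrr.
pose r y := sval (cid (qsurj y)).
have rK y : q (r y) = y by exact: svalP (cid (qsurj y)).
exists (ev \o r); split=> /=.
- by move=> x y; rewrite -evD; apply/eq_ev; rewrite linearD !rK.
- by move=> x y /eq_ev; rewrite !rK.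
- move=> y; exists (q (pure_tensor n (perm_diagram 1) y)).
  by rewrite -[RHS]rho1 -ev_pure; apply/eq_ev; rewrite rK.
- by move=> a x; rewrite -ev_scale; apply/eq_ev; rewrite rK linearZ /= rK.
Qed.

End Inflation.

(** * The exterior power model of hook Specht modules *)

Lemma lift_lift0 m (a : 'I_m.+1) (c : 'I_m) :
  lift (lift ord0 a) (lift ord0 c) = lift ord0 (lift a c) :> 'I_m.+2.
Proof. by apply: val_inj; rewrite /= /bump !add1n ltnS addnS. Qed.

Lemma lift_lift_ord0 m (a : 'I_m.+1) : lift (lift ord0 a) (ord0 : 'I_m.+1) = ord0.
Proof. exact: val_inj. Qed.

Section HookModel.
Variables (k : fieldType) (n : nat).

Notation tup m := {ffun 'I_m -> 'I_n}.
Notation tensors m := {ffun tup m -> k^o}.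

Definition tuple_cons m (z : 'I_n) (x : tup m) : tup m.+1 :=
  [ffun a => if unlift ord0 a is Some c then x c else z].

Definition tuple_drop m (a : 'I_m.+1) (x : tup m.+1) : tup m := [ffun c => x (lift a c)].

Definition tuple_move m (s : 'S_n) (x : tup m) : tup m := [ffun a => s (x a)].

Definition move m (s : 'S_n) (F : tensors m) : tensors m := [ffun x => F (tuple_move s x)].

(** The determinant of this matrix is the boundary of the simplex with vertices
    I, evaluated at x: by expansion along the row of ones, it is the alternating
    sum over b of the determinants of the [x a = I c] with c different from b. *)
Definition bordered m (I : tup m.+1) (x : tup m) : 'M[k]_m.+1 :=
  \matrix_(a, b) if unlift ord0 a is Some c then (x c == I b)%:R else 1.

Definition hook_vec m (I : tup m.+1) : tensors m := [ffun x => \det (bordered I x)].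

Definition in_hook m (F : tensors m) : Prop :=
  exists c : tup m.+1 -> k, F = \sum_I c I *: hook_vec I.

(** The exterior product with the sum of the basis vectors of k^n. *)
Definition wedge m (F : tensors m) : tensors m.+1 :=
  [ffun x : tup m.+1 => \sum_(a < m.+1) (-1) ^+ a * F (tuple_drop a x)].

Definition contract m z (F : tensors m.+1) : tensors m := [ffun x => F (tuple_cons z x)].

Lemma moveD m s : {morph @move m s : F G / F + G}.
Proof. by move=> F G; apply/ffunP=> x; rewrite !ffunE. Qed.
Lemma moveZ m s c F : @move m s (c *: F) = c *: move s F.
Proof. by apply/ffunP=> x; rewrite !ffunE. Qed.
Lemma contractD m z : {morph @contract m z : F G / F + G}.
Proof. by move=> F G; apply/ffunP=> x; rewrite !ffunE. Qed.
Lemma contractZ m z c F : @contract m z (c *: F) = c *: contract z F.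
Proof. by apply/ffunP=> x; rewrite !ffunE. Qed.
Lemma wedgeD m : {morph @wedge m : F G / F + G}.
Proof.
move=> F G; apply/ffunP=> x; rewrite !ffunE -big_split; apply: eq_bigr => a _ /=.
by rewrite !ffunE mulrDr.
Qed.
Lemma wedgeZ m c F : @wedge m (c *: F) = c *: wedge F.
Proof.
apply/ffunP=> x; rewrite !ffunE scaler_sumr; apply: eq_bigr => a _ /=.
by rewrite !ffunE; exact: mulrCA.
Qed.

Lemma wedge_move m s F : @wedge m (move s F) = move s (wedge F).
Proof.
apply/ffunP=> x; rewrite !ffunE; apply: eq_bigr => a _; rewrite ffunE.
by congr (_ * F _); apply/ffunP=> c; rewrite !ffunE.
Qed.

Lemma in_hook_vec m I : in_hook (@hook_vec m I).
Proof.
exists (fun J => (J == I)%:R); rewrite (bigD1 I) //= eqxx scale1r big1 ?addr0 //.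
by move=> J /negPf->; rewrite scale0r.
Qed.

Lemma in_hook_lincomb m c F G : @in_hook m F -> in_hook G -> in_hook (c *: F + G).
Proof.
case=> f -> [g ->]; exists (fun I => c * f I + g I).
rewrite scaler_sumr -big_split; apply: eq_bigr => I _ /=.
by rewrite scalerA -scalerDl.
Qed.

Lemma in_hook0 m : in_hook (0 : tensors m).
Proof. by exists (fun _ => 0); rewrite big1 // => I _; rewrite scale0r. Qed.

Lemma in_hook_ind m (Q : tensors m -> Prop) : Q 0 ->
  (forall c F G, Q F -> Q G -> Q (c *: F + G)) -> (forall I, Q (hook_vec I)) ->
  forall F, in_hook F -> Q F.
Proof.
move=> Q0 QP QI F [c ->]; elim/big_rec: _ => // I G _; exact: QP.
Qed.

Lemma in_hook_sum m I (r : seq I) (F : I -> tensors m) :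
  (forall i, in_hook (F i)) -> in_hook (\sum_(i <- r) F i).
Proof.
move=> H; elim/big_rec: _ => [|i G _ HG]; first exact: in_hook0.
by rewrite -[F i]scale1r; apply: in_hook_lincomb.
Qed.

Lemma in_hookZ m c F : @in_hook m F -> in_hook (c *: F).
Proof. by move=> H; rewrite -[_ *: _]addr0; apply: in_hook_lincomb => //; apply: in_hook0. Qed.

Lemma move_hook_vec m s (I : tup m.+1) : move s (hook_vec I) = hook_vec (tuple_move s^-1%g I).
Proof.
apply/ffunP=> x; rewrite !ffunE; congr (\det _); apply/matrixP=> a b; rewrite !mxE.
by case: unlift => // c; rewrite !ffunE (canF_eq (permK s)).
Qed.

(** The sum over y is linear in the first column of the bordered matrix, and turns
    it into n = 0 above ones; expansion along this column gives the terms of the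
    exterior product. This is the anticommutation of boundary and exterior product
    on the simplex I, whose right-hand side n vanishes in k. *)
Lemma wedge_hook_vec m (I : tup m.+1) : n%:R = 0 :> k ->
  wedge (hook_vec I) = - \sum_y hook_vec (tuple_cons y I).
Proof.
move=> n0; apply/ffunP=> x; rewrite !ffunE sum_ffunE.
under [X in _ = - X]eq_bigr => y _ do rewrite ffunE (expand_det_col _ ord0).
rewrite exchange_big /= [in RHS]big_ord_recl.
have minor y c : row' (lift ord0 c) (col' ord0 (bordered (tuple_cons y I) x)) =
    bordered I (tuple_drop c x).
  apply/matrixP=> a b; rewrite !mxE; case: (unliftP ord0 a) => [d ->|->].
    by rewrite lift_lift0 !liftK !ffunE liftK.
  by rewrite lift_lift_ord0 !unlift_none.
rewrite [X in _ = - (X + _)](_ : _ = 0) ?add0r; last first.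
  have -> : \sum_y bordered (tuple_cons y I) x ord0 ord0 * cofactor (bordered (tuple_cons y I) x) ord0 ord0
      = \sum_(y : 'I_n) \det (\matrix_(a < m.+1, b < m.+1) (x a == I b)%:R).
    apply: eq_bigr => y _; rewrite !mxE unlift_none mul1r /cofactor expr0 mul1r.
    congr (\det _); apply/matrixP=> a b; rewrite !mxE !liftK ffunE liftK //.
  by rewrite sumr_const card_ord -mulr_natl n0 mul0r.
rewrite -sumrN; apply: eq_bigr => c _; rewrite ffunE.
under eq_bigr => y _ do rewrite /cofactor minor addn0 mxE liftK ffunE unlift_none.
rewrite -mulr_suml (bigD1 (x c)) //= eqxx big1 => [|y /negPf yx]; last by rewrite eq_sym yx.
by rewrite addr0 mul1r /bump add1n exprS !mulNr mul1r opprK.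
Qed.

Lemma in_hook_wedge m F : n%:R = 0 :> k -> @in_hook m F -> in_hook (wedge F).
Proof.
move=> n0; move: F; apply: in_hook_ind => [|c G H|I].
- by rewrite -(scale0r 0) wedgeZ scale0r; exact: in_hook0.
- by rewrite wedgeD wedgeZ; apply: in_hook_lincomb.
rewrite wedge_hook_vec // -scaleN1r; apply/in_hookZ/in_hook_sum => y; exact: in_hook_vec.
Qed.

(** Expansion along the second row of the bordered matrix, which compares z with
    the vertices. *)
Lemma in_hook_contract m z F : @in_hook m.+1 F -> in_hook (contract z F).
Proof.
move: F; apply: in_hook_ind => [|c G H|I].
- by rewrite -(scale0r 0) contractZ scale0r; exact: in_hook0.
- by rewrite contractD contractZ; apply: in_hook_lincomb.
have -> : contract z (hook_vec I) =
    \sum_b ((z == I b)%:R * (-1) ^+ b.+1) *: hook_vec (tuple_drop b I).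
  apply/ffunP=> x; rewrite !ffunE sum_ffunE (expand_det_row _ (lift ord0 ord0)).
  apply: eq_bigr => b _; rewrite !ffunE mxE liftK !ffunE unlift_none /cofactor lift0 add1n.
  rewrite -[RHS]mulrA; congr (_ * (_ * \det _)); apply/matrixP=> a c; rewrite !mxE.
  case: (unliftP ord0 a) => [d ->|->].
    by rewrite lift_lift0 !liftK !ffunE liftK.
  by rewrite lift_lift_ord0 !unlift_none.
by apply/in_hook_sum => b; apply/in_hookZ/in_hook_vec.
Qed.

Lemma tuple_drop_cons0 m z (x : tup m) : tuple_drop ord0 (tuple_cons z x) = x.
Proof. by apply/ffunP=> c; rewrite !ffunE liftK. Qed.

(** The contracting homotopy that makes the complex exact. *)
Lemma wedge_contract m z (F : tensors m.+1) :
  contract z (wedge F) + wedge (contract z F) = F.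
Proof.
apply/ffunP=> x; rewrite !ffunE big_ord_recl /= expr0 mul1r.
rewrite tuple_drop_cons0 -addrA -big_split big1 ?addr0 //= => a _; rewrite !ffunE.
have -> : tuple_drop (lift ord0 a) (tuple_cons z x) = tuple_cons z (tuple_drop a x).
  apply/ffunP=> c; rewrite !ffunE; case: (unliftP ord0 c) => [d ->|->].
    by rewrite lift_lift0 !liftK ffunE.
  by rewrite lift_lift_ord0 !unlift_none.
by rewrite /bump add1n exprS !mulNr mul1r addNr.
Qed.

Lemma wedge_exact m F : @in_hook m.+1 F -> wedge F = 0 -> (0 < n)%N ->
  exists2 G, in_hook G & wedge G = F.
Proof.
move=> FK F0 n0; exists (contract (Ordinal n0) F); first exact: in_hook_contract.
rewrite -[RHS](wedge_contract (Ordinal n0)) F0 [X in X + _](_ : _ = 0) ?add0r //.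
by apply/ffunP=> x; rewrite !ffunE.
Qed.

Lemma wedge_inj0 (F : tensors 0) : (0 < n)%N -> wedge F = 0 -> F = 0.
Proof.
move=> n0 /ffunP H; apply/ffunP=> x; have := H [ffun => Ordinal n0].
rewrite !ffunE big_ord1 expr0 mul1r => <-; congr (F _).
by apply/ffunP; case.
Qed.

Lemma tuple_consK m (x : tup m.+1) : tuple_cons (x ord0) (tuple_drop ord0 x) = x.
Proof. by apply/ffunP=> a; rewrite !ffunE; case: unliftP => [c ->|->] //; rewrite ffunE. Qed.

(** By the homotopy, contraction with z anticommutes with the product up to the
    identity, so it turns this vanishing into the same one in one variable less. *)
Lemma wedge_wedge m (F : tensors m) : wedge (wedge F) = 0.
Proof.
have by_contract m' (G : tensors m'.+1) : (forall z, contract z G = 0) -> G = 0.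
  move=> H; apply/ffunP=> x; move/ffunP/(_ (tuple_drop ord0 x)): (H (x ord0)).
  by rewrite !ffunE tuple_consK.
elim: m F => [|m IH] F; apply: by_contract => z;
  apply: (addIr (wedge (contract z (wedge F)))); rewrite wedge_contract add0r.
  congr wedge; apply/ffunP=> x; rewrite !ffunE big_ord1 expr0 mul1r.
  by rewrite tuple_drop_cons0.
have wedgeN G : wedge (- G) = - wedge G :> tensors m.+2 by rewrite -scaleN1r wedgeZ scaleN1r.
have -> : contract z (wedge F) = F - wedge (contract z F).
  by rewrite -[F in F - _](wedge_contract z) addrK.
by rewrite wedgeD wedgeN IH subr0.
Qed.

Lemma hook_vec_noninj m (I : tup m.+1) b c : b != c -> I b = I c -> hook_vec I = 0.
Proof.
move=> bc e; apply/ffunP=> x; rewrite !ffunE -det_tr.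
by apply: (determinant_alternate bc) => a; rewrite !mxE e.
Qed.

Lemma hook_vec_base m (I : tup m.+1) : injective I -> hook_vec I (tuple_drop ord0 I) = 1.
Proof.
move=> Iinj; rewrite ffunE -det_tr det_trig.
  by rewrite big1 // => a _; rewrite !mxE; case: unliftP => // c ->; rewrite ffunE eqxx.
apply/forallP=> a; apply/forallP=> b; apply/implyP=> ab; rewrite !mxE.
case: unliftP ab => [c ->|->]; last by rewrite ltn0.
by rewrite ffunE (inj_eq Iinj) -val_eqE => ab; rewrite gtn_eqF.
Qed.

(** A permutation of the arguments permutes the rows of the bordered matrix other
    than the row of ones. *)
Lemma hook_alternating m (F : tensors m) (s : 'S_m) (x : tup m) : in_hook F ->
  F [ffun a => x (s a)] = (-1) ^+ s * F x.
Proof.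
move: F; apply: in_hook_ind => [|c F G FH GH|I].
- by rewrite !ffunE mulr0.
- by rewrite !ffunE FH GH mulrDr mulrCA.
rewrite !ffunE; have -> : bordered I [ffun a => x (s a)] = row_perm (lift0_perm s) (bordered I x).
  apply/matrixP=> a b; rewrite !mxE; case: (unliftP ord0 a) => [c ->|->].
    by rewrite lift0_perm_lift !liftK ffunE.
  by rewrite lift0_perm0 unlift_none.
by rewrite row_permE det_mulmx det_perm odd_lift_perm.
Qed.

End HookModel.

(** * Antisymmetrisation over the vertices of a simplex *)

Section PermExtension.
Variables (n q : nat) (I : {ffun 'I_q -> 'I_n}).
Hypothesis I_inj : injective I.

Definition extend_fun (r : 'S_q) (y : 'I_n) : 'I_n :=
  if [pick b | I b == y] is Some b then I (r b) else y.

Lemma extend_fun_in r b : extend_fun r (I b) = I (r b).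
Proof.
by rewrite /extend_fun; case: pickP => [c /eqP/I_inj->|/(_ b)]; rewrite ?eqxx.
Qed.

Lemma extend_fun_out r y : (forall b, I b != y) -> extend_fun r y = y.
Proof. by rewrite /extend_fun; case: pickP => // b /eqP <- /(_ b); rewrite eqxx. Qed.

Lemma in_image_dec y : (exists b, I b = y) \/ (forall b, I b != y).
Proof.
have [b /eqP e|no] := pickP (fun b => I b == y); first by left; exists b.
by right=> b; rewrite no.
Qed.

Lemma extend_fun_inj r : injective (extend_fun r).
Proof.
move=> y z; case: (in_image_dec y) => [[b <-]|yo]; case: (in_image_dec z) => [[c <-]|zo].
- by rewrite !extend_fun_in => /I_inj/perm_inj->.
- by rewrite extend_fun_in extend_fun_out // => e; have := zo (r b); rewrite e eqxx.
- by rewrite extend_fun_in extend_fun_out // => e; have := yo (r c); rewrite e eqxx.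
- by rewrite !extend_fun_out.
Qed.

Definition extend_perm (r : 'S_q) : 'S_n := perm (@extend_fun_inj r).

Lemma extend_perm_in r b : extend_perm r (I b) = I (r b).
Proof. by rewrite permE extend_fun_in. Qed.

Lemma extend_perm_out r y : (forall b, I b != y) -> extend_perm r y = y.
Proof. by rewrite permE; apply: extend_fun_out. Qed.

Lemma extend_permM s r : extend_perm (s * r)%g = (extend_perm s * extend_perm r)%g.
Proof.
apply/permP=> y; rewrite permM; case: (in_image_dec y) => [[b <-]|yo].
  by rewrite !extend_perm_in permM.
by rewrite !extend_perm_out.
Qed.

Lemma extend_perm1 : extend_perm 1 = 1%g.
Proof.
apply/permP=> y; rewrite perm1; case: (in_image_dec y) => [[b <-]|yo].
  by rewrite extend_perm_in perm1.
by rewrite extend_perm_out.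
Qed.

Lemma extend_tperm b c : extend_perm (tperm b c) = tperm (I b) (I c).
Proof.
apply/permP=> y; case: (in_image_dec y) => [[d <-]|yo].
  rewrite extend_perm_in; case: tpermP => [->|->|/eqP db /eqP dc].
  - by rewrite tpermL.
  - by rewrite tpermR.
  - by rewrite tpermD // inj_eq // eq_sym.
by rewrite extend_perm_out // tpermD.
Qed.

(** Extension by the identity is multiplicative and maps transpositions to
    transpositions. *)
Lemma odd_extend_perm r : odd_perm (extend_perm r) = odd_perm r.
Proof.
have [ts -> _] := prod_tpermP r.
elim: ts => [|t ts IH]; first by rewrite big_nil extend_perm1 !odd_perm1.
by rewrite big_cons extend_permM !odd_permM IH extend_tperm !odd_tperm inj_eq.
Qed.

Lemma extend_perm_inj : injective extend_perm.
Proof.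
by move=> r s e; apply/permP=> b; apply: I_inj; rewrite -!extend_perm_in e.
Qed.

End PermExtension.

Lemma eq_opp_eq0 (k : fieldType) (x : k) : (2%:R != 0 :> k) -> x = - x -> x = 0.
Proof.
move=> c2 /eqP; rewrite -subr_eq0 opprK -mulr2n -mulr_natr mulf_eq0 (negPf c2) orbF.
by move/eqP.
Qed.

(** Left multiplication by t pairs the terms of the sum with opposite signs. *)
Lemma signed_sum_vanish (k : fieldType) q (C : {set 'S_q}) (t : 'S_q) (g : 'S_q -> k) :
  2%:R != 0 :> k -> odd_perm t -> (forall s, ((t * s)%g \in C) = (s \in C)) ->
  (forall s, g (t * s)%g = g s) -> \sum_(s in C) (-1) ^+ s * g s = 0.
Proof.
move=> c2 ot Ct gt; apply: eq_opp_eq0 => //.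
rewrite {1}(reindex_inj (mulgI t)) /= -sumrN; apply: eq_big => // s _.
by rewrite odd_permM ot signr_addb expr1 gt mulN1r mulNr.
Qed.

(** Each of I and J is completed to an enumeration of all entries by listing the
    remaining ones, and s matches the two enumerations. *)
Lemma perm_between n q (I J : {ffun 'I_q -> 'I_n}) : injective I -> injective J ->
  exists s : 'S_n, forall b, s (I b) = J b.
Proof.
pose full (I : {ffun 'I_q -> 'I_n}) := codom I ++ [seq y <- enum 'I_n | y \notin codom I].
have fullE (K : {ffun 'I_q -> 'I_n}) : injective K ->
    [/\ uniq (full K), forall y, y \in full K, size (full K) = n &
        forall (b : 'I_q) (y0 : 'I_n), nth y0 (full K) b = K b].
  move=> Kinj; have u : uniq (full K).
    rewrite cat_uniq filter_uniq ?enum_uniq // map_inj_uniq ?enum_uniq //= andbT.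
    by apply/hasPn=> y; rewrite mem_filter => /andP[].
  have all_in y : y \in full K.
    by rewrite mem_cat mem_filter mem_enum andbT orbN.
  split=> // [|b y0].
    rewrite -[RHS](card_ord n) cardE; apply/perm_size/uniq_perm => // [|y].
      exact: enum_uniq.
    by rewrite all_in mem_enum.
  rewrite nth_cat size_codom card_ord ltn_ord codomE (nth_map b) ?size_enum_ord //.
  by rewrite nth_ord_enum.
move=> /fullE[uI aI sI nI] /fullE[uJ aJ sJ nJ].
pose f y := nth y (full J) (index y (full I)).
have finj : injective f.
  have lt v : (index v (full I) < size (full J))%N by rewrite (etrans sJ (esym sI)) index_mem.
  move=> y z; rewrite /f (set_nth_default y z) // => /eqP.
  by rewrite nth_uniq // => /eqP; apply: index_inj.
exists (perm finj) => b; rewrite permE /f -[X in index X _](nI b (I b)) index_uniq //.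
by rewrite size_cat size_codom card_ord ltn_addr.
Qed.

Section Antisymmetrize.
Variables (k : fieldType) (n : nat).
Notation tup m := {ffun 'I_m -> 'I_n}.
Notation tensors m := {ffun tup m -> k^o}.

Definition antisymmetrize m (I : tup m.+1) (I_inj : injective I) (F : tensors m) : tensors m :=
  \sum_(r : 'S_m.+1) (-1) ^+ r *: move (extend_perm I_inj r) F.

Lemma hook_vec_sum m (I : tup m.+1) x : hook_vec k I x =
  \sum_(r : 'S_m.+1) (-1) ^+ r * \prod_(a < m) (x a == I (r (lift ord0 a)))%:R.
Proof.
rewrite ffunE; apply: eq_bigr => r _; congr (_ * _).
rewrite big_ord_recl mxE unlift_none mul1r; apply: eq_bigr => a _.
by rewrite mxE liftK.
Qed.

Lemma sum_delta m (F : tensors m) (J : tup m) :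
  \sum_x F x * \prod_(a < m) (x a == J a)%:R = F J.
Proof.
rewrite (bigD1 J) //= [X in _ * X]big1 ?mulr1 => [|a _]; last by rewrite eqxx.
rewrite big1 ?addr0 // => x xJ.
have [a /negPf xa] : exists a, x a != J a.
  by apply/existsP; apply: contraNT xJ => /existsPn H; apply/eqP/ffunP=> a; apply/eqP/negbNE/H.
by rewrite (bigD1 a) //= xa mul0r mulr0.
Qed.

(** Both sides are the pairing of F with hook_vec I, summed over all tuples. The
    Leibniz formula for the determinant gives the left-hand side. Expansion along
    the row of ones gives the right-hand side: the minor at b pairs with F to m!
    times the value of F on I without its vertex b, since F is alternating. *)
Lemma antisymmetrize_base m (I : tup m.+1) (F : tensors m) : in_hook F ->
  \sum_(r : 'S_m.+1) (-1) ^+ r * F [ffun a => I (r (lift ord0 a))] = m`!%:R * wedge F I.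
Proof.
move=> FK; transitivity (\sum_x F x * hook_vec k I x).
  under [RHS]eq_bigr => x _ do rewrite hook_vec_sum mulr_sumr.
  rewrite exchange_big; apply: eq_bigr => r _ /=.
  rewrite -(sum_delta F) mulr_sumr; apply: eq_bigr => x _; rewrite mulrCA.
  by congr (_ * (_ * _)); apply: eq_bigr => a _; rewrite ffunE.
under eq_bigr => x _ do rewrite ffunE (expand_det_row _ ord0) mulr_sumr.
rewrite exchange_big ffunE mulr_sumr; apply: eq_bigr => b _ /=.
transitivity (\sum_x \sum_(s : 'S_m) (-1) ^+ b * ((-1) ^+ s *
    (F x * \prod_(a < m) (x a == [ffun a => tuple_drop b I (s a)] a)%:R))).
  apply: eq_bigr => x _; rewrite mxE unlift_none mul1r /cofactor add0n.
  rewrite mulrCA /determinant mulr_sumr mulr_sumr; apply: eq_bigr => s _.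
  congr (_ * _); rewrite mulrCA; congr (_ * (_ * _)); apply: eq_bigr => a _.
  by rewrite !mxE liftK !ffunE.
rewrite exchange_big /=.
transitivity (\sum_(s : 'S_m) (-1) ^+ b * F (tuple_drop b I)).
  apply: eq_bigr => s _; rewrite -mulr_sumr -mulr_sumr sum_delta hook_alternating //.
  by rewrite signrMK.
by rewrite sumr_const (eq_card (B := [in 'S_m])) ?card_Sn ?mulr_natl.
Qed.

Lemma antisymmetrize_missing m (I : tup m.+1) (I_inj : injective I) F (x : tup m) b c :
  (2%:R != 0 :> k) -> b != c ->
  (forall a, x a != I b) -> (forall a, x a != I c) -> antisymmetrize I_inj F x = 0.
Proof.
move=> c2 bc xb xc; rewrite /antisymmetrize sum_ffunE.
transitivity (\sum_(r in [set: 'S_m.+1]) (-1) ^+ r * F (tuple_move (extend_perm I_inj r) x)).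
  by apply: eq_big => [r|r _]; rewrite ?inE // !ffunE.
apply: (signed_sum_vanish (t := tperm b c)) => // [|r|r]; first by rewrite odd_tperm.
  by rewrite !inE.
congr (F _); apply/ffunP=> a.
by rewrite !ffunE extend_permM permM extend_tperm tpermD // eq_sym.
Qed.

Lemma hook_vec_missing m (I : tup m.+1) (x : tup m) b c : b != c ->
  (forall a, x a != I b) -> (forall a, x a != I c) -> hook_vec k I x = 0.
Proof.
move=> bc xb xc; rewrite ffunE -det_tr.
apply: (determinant_alternate bc) => a; rewrite !mxE.
by case: unlift => // d; rewrite (negPf (xb d)) (negPf (xc d)).
Qed.

(** If x misses at most one vertex of I, it takes m different values, all of them
    vertices, and becomes a permutation of the vertices once the missing vertex is
    put in front. *)
Lemma tuple_missing_or_perm m (I : tup m.+1) (x : tup m) : injective I ->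
  (exists b c, [/\ b != c, forall a, x a != I b & forall a, x a != I c]) \/
  (exists w : 'S_m.+1, forall a, x a = I (w (lift ord0 a))).
Proof.
move=> Iinj; pose X := [set x a | a : 'I_m]; pose B := [set b | I b \notin X].
have outX b : I b \notin X -> forall a, x a != I b.
  by move=> bX a; apply: contraNneq bX => <-; apply: imset_f.
have [/card_gt1P[b [c [bB cB bc]]]|B1] := ltnP 1 #|B|.
  by left; exists b, c; rewrite !inE in bB cB; split=> //; apply: outX.
right; pose IB := I @: ~: B.
have cIB : (m <= #|IB|)%N.
  rewrite card_imset // -(leq_add2l #|B|) cardsC card_ord.
  by apply: leq_trans (leq_add B1 (leqnn m)) _; rewrite add1n.
have sub : IB \subset X.
  by apply/subsetP=> y /imsetP[b bB ->]; move: bB; rewrite !inE negbK.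
have cX : (#|X| <= m)%N by rewrite (leq_trans (leq_imset_card _ _)) // cardT size_enum_ord.
have /eqP eX : IB == X by rewrite eqEcard sub (leq_trans cX).
have xinj : injective x.
  have XE : X = x @: [set: 'I_m] by apply/setP=> y; apply/imsetP/imsetP=> -[z _ ->]; exists z.
  have : #|X| == #|[set: 'I_m]| by rewrite cardsT card_ord eqn_leq cX -eX.
  by rewrite XE => /imset_injP H a a' e; apply: H; rewrite ?inE.
have ex a : exists b, x a = I b.
  have : x a \in IB by rewrite eX imset_f.
  by case/imsetP=> b _ ->; exists b.
have [g gE] := fin_all_exists ex.
have ginj : injective g by move=> a a' e; apply: xinj; rewrite !gE e.
have [z zg] : exists z, z \notin codom g.
  apply/existsP; rewrite -negb_forall; apply/negP=> /forallP H.
  have : (#|'I_m.+1| <= #|codom g|)%N by apply/subset_leq_card/subsetP=> y _; apply: H.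
  by rewrite card_codom // !card_ord ltnn.
pose w a := if unlift ord0 a is Some c then g c else z.
have winj : injective w.
  move=> a a'; rewrite /w; case: unliftP => [c ->|->]; case: unliftP => [c' ->|->] //.
  - by move/ginj->.
  - by move=> e; rewrite -e codom_f in zg.
  - by move=> e; rewrite e codom_f in zg.
by exists (perm winj) => a; rewrite permE /w liftK gE.
Qed.

Lemma hook_vec_perm m (I : tup m.+1) (w : 'S_m.+1) : injective I ->
  hook_vec k I [ffun a => I (w (lift ord0 a))] = (-1) ^+ w.
Proof.
move=> Iinj; rewrite ffunE; have -> : bordered k I [ffun a => I (w (lift ord0 a))] =
    col_perm w^-1 (bordered k I (tuple_drop ord0 I)).
  apply/matrixP=> a b; rewrite !mxE; case: unlift => // c; rewrite !ffunE !(inj_eq Iinj).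
  by rewrite (canF_eq (permK w)).
have := hook_vec_base k Iinj; rewrite ffunE col_permE det_mulmx => ->.
by rewrite invgK det_perm mul1r.
Qed.

(** At a tuple that misses two vertices, both sides vanish, as the transposition of
    these vertices fixes the tuple. Any other tuple is a permutation of the vertices
    with its first one dropped, and both sides change by the sign of this
    permutation; so it suffices to compare them at one tuple. *)
Lemma antisymmetrizeE m (I : tup m.+1) (I_inj : injective I) (F : tensors m) :
  (2%:R != 0 :> k) -> in_hook F ->
  antisymmetrize I_inj F = (m`!%:R * wedge F I) *: hook_vec k I.
Proof.
move=> c2 FK; apply/ffunP=> x; rewrite [RHS]ffunE.
have [[b [c [bc xb xc]]]|[w xE]] := tuple_missing_or_perm x I_inj.
  by rewrite (antisymmetrize_missing _ _ c2 bc) // (hook_vec_missing bc) // scaler0.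
have -> : x = [ffun a => I (w (lift ord0 a))] by apply/ffunP=> a; rewrite xE ffunE.
rewrite hook_vec_perm // -antisymmetrize_base // /antisymmetrize sum_ffunE.
rewrite [RHS]mulrC mulr_sumr [RHS](reindex_inj (mulgI w)) /=; apply: eq_bigr => r _.
rewrite odd_permM signr_addb !mulrA -expr2 sqrr_sign mul1r !ffunE.
by congr (_ * F _); apply/ffunP=> a; rewrite !ffunE extend_perm_in permM.
Qed.

Lemma wedge_noninj m (F : tensors m) (I : tup m.+1) b c : (2%:R != 0 :> k) -> n%:R = 0 :> k ->
  in_hook F -> b != c -> I b = I c -> wedge F I = 0.
Proof.
move=> c2 n0 FK bc e; apply: eq_opp_eq0 => //.
have := hook_alternating (tperm b c) I (in_hook_wedge n0 FK).
rewrite odd_tperm bc expr1 mulN1r => <-; congr (wedge F _); apply/ffunP=> a.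
by rewrite ffunE; case: tpermP => [->|->|].
Qed.

Lemma wedge_neq0 m (F : tensors m) : (2%:R != 0 :> k) -> n%:R = 0 :> k -> in_hook F ->
  wedge F <> 0 -> exists2 I : tup m.+1, injective I & wedge F I != 0.
Proof.
move=> c2 n0 FK F0; have [I FI] : exists I, wedge F I != 0.
  apply/existsP; rewrite -negb_forall; apply/negP=> /forallP H; apply: F0.
  by apply/ffunP=> I; rewrite [RHS]ffunE; apply/eqP.
exists I => // b c e; apply/eqP; apply: contraNT FI => bc; apply/eqP.
exact: wedge_noninj bc e.
Qed.

(** By wedge_hook_vec the value is minus the number n - (m + 1) of the points y
    outside the simplex, as the term of y is 1 for these and 0 for the vertices. *)
Lemma wedge_hook_vec_base m (I : tup m.+1) : n%:R = 0 :> k -> injective I ->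
  wedge (hook_vec k I) I = m.+1%:R.
Proof.
move=> n0 Iinj; rewrite wedge_hook_vec // ffunE sum_ffunE.
have E y : hook_vec k (tuple_cons y I) I = (y \notin codom I)%:R.
  have [/codomP[b ->]|yI] := boolP (y \in codom I).
    rewrite (@hook_vec_noninj _ _ _ _ ord0 (lift ord0 b)) //.
      by rewrite ffunE.
    by rewrite !ffunE unlift_none liftK.
  have Jinj : injective (tuple_cons y I).
    move=> a a'; rewrite !ffunE; case: unliftP => [c ->|->]; case: unliftP => [c' ->|->] //.
    - by move/Iinj->.
    - by move=> e; rewrite -e codom_f in yI.
    - by move=> e; rewrite e codom_f in yI.
  rewrite -(hook_vec_base k Jinj); congr (hook_vec k _ _); apply/ffunP=> a.
  by rewrite !ffunE liftK.
under eq_bigr => y _ do rewrite E.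
apply/eqP; rewrite eq_sym -subr_eq0 opprK; apply/eqP.
have <- : \sum_(y : 'I_n) (y \in codom I)%:R = m.+1%:R :> k.
  have cI : #|codom I| = m.+1 by rewrite card_codom // card_ord.
  rewrite -[in RHS]cI -sum1_card natr_sum [RHS]big_mkcond.
  by apply: eq_bigr => y _; case: (y \in _).
rewrite -big_split /=; under eq_bigr => y _ do rewrite -natrD addnC addn_negb.
by rewrite sumr_const card_ord; exact: n0.
Qed.

End Antisymmetrize.

(** * Tabloids of hook shape as tuples *)

Lemma span_ind (k : fieldType) (V : vectType k) (X : seq V) (Q : V -> Prop) :
  Q 0 -> (forall c u v, Q u -> Q v -> Q (c *: u + v)) ->
  (forall v, v \in X -> Q v) -> forall v, v \in <<X>>%VS -> Q v.
Proof.
move=> Q0 QP QX v /(coord_span (X := in_tuple X))->.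
elim/big_rec: _ => // i w _; apply/QP/QX.
by rewrite /= mem_nth.
Qed.

Lemma specht_ind (k : fieldType) (la : seq nat)
    (Q : {ffun {ffun 'I_(sumn la) -> 'I_(size la)} -> k^o} -> Prop) :
  Q 0 -> (forall c u v, Q u -> Q v -> Q (c *: u + v)) ->
  (forall T, Q (polytabloid k T)) -> forall v, v \in specht k la -> Q v.
Proof.
move=> Q0 QP QT; apply: span_ind => // _ /mapP[T _ ->]; exact: QT.
Qed.

Lemma polytabloid_specht (k : fieldType) (la : seq nat) T : polytabloid k T \in specht k la.
Proof. by apply: memv_span; apply/mapP; exists T; rewrite ?mem_enum. Qed.

Section HookSpecht.
Variables (k : fieldType) (h : nat) (l : seq nat).
Hypotheses (h_gt0 : (0 < h)%N) (l1 : all (pred1 1%N) l).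
Notation la := (h :: l).
Notation N := (sumn la).
Notation m := (size l).
Notation tabloid := {ffun 'I_N -> 'I_(size la)}.
Notation tuples := {ffun 'I_m -> 'I_N}.

Lemma nth_hook_gt0 (b : 'I_(size la)) : (0 < nth 0%N la b)%N.
Proof.
case: b => [[|b] //= bm]; rewrite ltnS in bm.
by have /eqP-> := all_nthP 0%N l1 b bm.
Qed.

(** The cells of the first column, numbered by their row. *)
Definition leg_cell (b : 'I_(size la)) : 'I_N := Ordinal (flatten_indexP (nth_hook_gt0 b)).

Lemma row_leg b : row_of (leg_cell b) = b.
Proof. by apply: val_inj; rewrite /= flatten_indexKl // nth_hook_gt0. Qed.
Lemma col_leg b : col_of (leg_cell b) = 0%N.
Proof. by rewrite /col_of /= flatten_indexKr // nth_hook_gt0. Qed.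

Lemma leg_inj : injective leg_cell.
Proof. by move=> b c e; rewrite -(row_leg b) e row_leg. Qed.

Lemma cell_ext (la' : seq nat) (i j : 'I_(sumn la')) : row_of i = row_of j -> col_of i = col_of j -> i = j.
Proof.
move=> /(congr1 val) /= r c; apply: val_inj => /=.
by rewrite -(reshape_indexK la' i) -(reshape_indexK la' j) r -!/(col_of _) c.
Qed.

Lemma col0_leg (i : 'I_N) : col_of i = 0%N -> i = leg_cell (row_of i).
Proof. by move=> c; apply: cell_ext; rewrite ?row_leg ?col_leg. Qed.

Lemma row_pos_leg (i : 'I_N) : row_of i != ord0 :> 'I_m.+1 -> i = leg_cell (row_of i).
Proof.
move=> r; apply: col0_leg; have := reshape_offsetP (ltn_ord i).
rewrite -/(col_of i) -[reshape_index la i]/(val (row_of i)).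
case: (row_of i) r => [[|b] //= bm] _; rewrite ltnS in bm.
by have /eqP-> := all_nthP 0%N l1 b bm; case: (col_of i).
Qed.

Definition leg (T : 'S_N) : {ffun 'I_m.+1 -> 'I_N} := [ffun b => T (leg_cell b)].

Lemma leg_tab_inj T : injective (leg T).
Proof. by move=> b c; rewrite !ffunE => /perm_inj/leg_inj. Qed.
Notation ext T := (extend_perm (leg_tab_inj (T := T))).

(** All columns but the first have length one, so the column stabilizer is the
    symmetric group of the entries of the first column. *)
Lemma column_stabilizer_hook T : column_stabilizer T = [set ext T r | r : 'S_m.+1].
Proof.
apply/setP=> s; rewrite inE; apply/forallP/imsetP=> [H|[r _ ->] a]; last first.
  case: (in_image_dec (leg T) a) => [[b <-]|ao]; last by rewrite extend_perm_out.
  by rewrite extend_perm_in !ffunE !permK !col_leg.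
have ex b : exists c, s (leg T b) = leg T c.
  exists (row_of (T^-1%g (s (leg T b)))); rewrite [RHS]ffunE -col0_leg ?permKV //.
  by apply/eqP; rewrite (eqP (H _)) ffunE permK col_leg.
have [r rE] := fin_all_exists ex.
have rinj : injective r by move=> b c e; apply: (@leg_tab_inj T); apply: (@perm_inj _ s); rewrite !rE e.
exists (perm rinj) => //; apply/permP=> y.
case: (in_image_dec (leg T) y) => [[b <-]|yo]; first by rewrite extend_perm_in permE rE.
rewrite extend_perm_out //; apply: (@perm_inj _ T^-1%g).
have rowy z : (forall b, leg T b != z) -> row_of (T^-1%g z) = ord0.
  move=> zo; apply/eqP; apply: contraT => /row_pos_leg e.
  by have := zo (row_of (T^-1%g z)); rewrite ffunE -e permKV eqxx.
have cy := eqP (H y); have colpos : col_of (T^-1%g y) != 0%N.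
  apply/eqP=> /col0_leg e; have := yo (row_of (T^-1%g y)); by rewrite ffunE -e permKV eqxx.
apply: cell_ext => //; rewrite (rowy y yo); apply/eqP; apply: contraT => /row_pos_leg e.
by rewrite -cy e col_leg in colpos.
Qed.

Lemma tabloid_leg T b : tabloid_of T (leg T b) = b.
Proof. by rewrite !ffunE permK row_leg. Qed.

Lemma tabloid_out T y : (forall b, leg T b != y) -> tabloid_of T y = ord0.
Proof.
move=> yo; rewrite ffunE; apply/eqP; apply: contraT => /row_pos_leg e.
by have := yo (row_of (T^-1%g y)); rewrite ffunE -e permKV eqxx.
Qed.

(** A hook tabloid is known from the entries of its rows of length one; the others
    fill the first row. *)
Definition tuple_tabloid (x : tuples) : tabloid :=
  [ffun i => if [pick a | x a == i] is Some a then lift ord0 a else ord0].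

Lemma tuple_tabloid_in (x : tuples) a : injective x -> tuple_tabloid x (x a) = lift ord0 a.
Proof.
by move=> xinj; rewrite ffunE; case: pickP => [b /eqP/xinj->//|/(_ a)]; rewrite eqxx.
Qed.

Lemma tuple_tabloid_out (x : tuples) y : (forall a, x a != y) -> tuple_tabloid x y = ord0.
Proof. by move=> H; rewrite ffunE; case: pickP => // b /eqP e; have := H b; rewrite e eqxx. Qed.

Lemma tuple_tabloidE (x : tuples) T : injective x ->
  tuple_tabloid x = tabloid_of T <-> (forall a, x a = leg T (lift ord0 a)).
Proof.
move=> xinj; split=> [/ffunP H a|H].
  have := H (x a); rewrite tuple_tabloid_in //.
  case: (in_image_dec (leg T) (x a)) => [[b <-]|xo]; first by rewrite tabloid_leg => <-.
  by rewrite tabloid_out.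
apply/ffunP=> y; case: (in_image_dec (leg T) y) => [[b <-]|yo].
  rewrite tabloid_leg; case: (unliftP ord0 b) => [a ->|->].
    by rewrite -H tuple_tabloid_in.
  by apply: tuple_tabloid_out => a; rewrite H (inj_eq (@leg_tab_inj T)).
by rewrite tabloid_out // tuple_tabloid_out // => a; rewrite H.
Qed.

(** The value 0 at tuples with repeated entries makes the image of a
    polytabloid alternating. *)
Definition flatten_tabloids (f : {ffun tabloid -> k^o}) : {ffun tuples -> k^o} :=
  [ffun x : tuples => if injectiveb x then f (tuple_tabloid x) else 0].

Lemma flatten_tabloids_lincomb c f g :
  flatten_tabloids (c *: f + g) = c *: flatten_tabloids f + flatten_tabloids g.
Proof. by apply/ffunP=> x; rewrite !ffunE; case: ifP; rewrite // scaler0 addr0. Qed.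

Lemma flatten_tabloids_permute s f :
  flatten_tabloids (permute s f) = move s (flatten_tabloids f).
Proof.
apply/ffunP=> x; rewrite !ffunE.
have -> : injectiveb (tuple_move s x) = injectiveb x.
  apply/injectiveP/injectiveP=> H a b e; apply: H; move: e; rewrite ?ffunE.
    by move->.
  by move/perm_inj.
case: ifP => // _; congr (f _); apply/ffunP=> i; rewrite !ffunE.
have -> // : [pick a | x a == s^-1%g i] = [pick a | tuple_move s x a == i].
by apply: eq_pick => a; rewrite /= ffunE (canF_eq (permK s)).
Qed.

Lemma leg_mul T r b : leg (T * ext T r)%g b = leg T (r b).
Proof. by rewrite ffunE permM -[T _](ffunE (fun b => T (leg_cell b))) extend_perm_in. Qed.

(** Summing over the symmetric group of the leg of T gives the Leibniz formula for
    the bordered determinant. *)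
Lemma flatten_polytabloid T : flatten_tabloids (polytabloid k T) = hook_vec k (leg T).
Proof.
apply/ffunP=> x; rewrite hook_vec_sum ffunE /polytabloid sum_ffunE.
rewrite column_stabilizer_hook big_imset /=; last by move=> ? ? _ _; apply: extend_perm_inj.
case: injectiveP => [xinj|nx].
  apply: eq_big => // r _; rewrite !ffunE odd_extend_perm; congr (_ * _).
  have H := tuple_tabloidE (T * ext T r)%g xinj.
  case: eqP => [/H xE|ne]; first by rewrite big1 // => a _; rewrite xE leg_mul eqxx.
  have [a xa] : exists a, x a != leg T (r (lift ord0 a)).
    apply/existsP; apply: contraT; rewrite -negb_forall negbK => /forallP xE.
    by case: ne; apply/H => a; rewrite leg_mul; apply/eqP.
  by rewrite (bigD1 a) //= (negPf xa) mul0r.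
rewrite [RHS]big1 // => r _.
have [a xa] : exists a, x a != leg T (r (lift ord0 a)).
  apply/existsP; apply: contraT; rewrite -negb_forall negbK => /forallP xE.
  case: nx => a b; rewrite (eqP (xE a)) (eqP (xE b)) => /leg_tab_inj/perm_inj.
  exact: lift_inj.
by rewrite (bigD1 a) //= (negPf xa) mul0r mulr0.
Qed.

Lemma specht_support (f : {ffun tabloid -> k^o}) X : f \in specht k la -> f X != 0 ->
  exists T, X = tabloid_of T.
Proof.

move=> fS fX; apply: contrapT => no; case/eqP: fX.
move: f fS; apply: specht_ind => [|c u v uX vX|T].
- by rewrite ffunE.
- by rewrite !ffunE uX vX scaler0 addr0.
rewrite sum_ffunE big1 // => s _; rewrite !ffunE; case: eqP => [XE|]; rewrite ?scaler0 //.
by case: no; exists (T * s)%g.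
Qed.

(** Elements of the Specht module vanish off the functions that are tabloids of
    bijective tableaux, and every such tabloid comes from a tuple. *)
Lemma flatten_tabloids_inj f g : f \in specht k la -> g \in specht k la ->
  flatten_tabloids f = flatten_tabloids g -> f = g.
Proof.
move=> fS gS e; apply/eqP; rewrite -subr_eq0; set d := f - g.
have dS : d \in specht k la by rewrite memvB.
have d0 : flatten_tabloids d = 0.
  by rewrite /d addrC -scaleN1r flatten_tabloids_lincomb e scaleN1r addNr.
apply/eqP/ffunP=> X; rewrite [RHS]ffunE; apply/eqP; apply: contraT => dX.
have [T XE] := specht_support dS dX.
pose x : tuples := [ffun a => leg T (lift ord0 a)].
have xinj : injective x by move=> a b; rewrite !ffunE => /perm_inj/leg_inj/lift_inj.
move/ffunP/(_ x): d0; rewrite [LHS]ffunE [RHS]ffunE; have -> : injectiveb x by apply/injectiveP.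
rewrite (_ : tuple_tabloid x = X) => [d0|]; first by rewrite d0 eqxx in dX.
by rewrite XE; apply/tuple_tabloidE => // a; rewrite ffunE.
Qed.

Lemma flatten_specht F : in_hook F <-> exists2 f, f \in specht k la & flatten_tabloids f = F.
Proof.
split=> [|[f fS <-]].
  move: F; apply: in_hook_ind => [|c F G [f fS <-] [g gS <-]|I].
  - exists 0; first exact: mem0v.
    by apply/ffunP=> x; rewrite !ffunE if_same.
  - by exists (c *: f + g); rewrite ?flatten_tabloids_lincomb // memvD // memvZ.
  have [/injectiveP Iinj|/injectivePn[b [c bc e]]] := boolP (injectiveb I).
    have [s sE] := perm_between (leg_tab_inj (T := 1%g)) Iinj.
    exists (polytabloid k s); first exact: polytabloid_specht.
    rewrite flatten_polytabloid; congr (hook_vec k _); apply/ffunP=> b.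
    by rewrite -sE !ffunE perm1.
  exists 0; first exact: mem0v.
  rewrite (hook_vec_noninj _ bc e).
  by apply/ffunP=> x; rewrite !ffunE if_same.
move: f fS; apply: specht_ind => [|c u v|T].
- rewrite (_ : flatten_tabloids 0 = 0); first exact: in_hook0.
  by apply/ffunP=> x; rewrite !ffunE if_same.
- by rewrite flatten_tabloids_lincomb; apply: in_hook_lincomb.
- by rewrite flatten_polytabloid; apply: in_hook_vec.
Qed.

End HookSpecht.

(** * Concrete models of cell modules *)

Section Models.
Variables (k : fieldType) (n : nat) (delta : k).
Local Notation P := (partition_algebra n delta).

Definition signed_sum (C : {set 'S_n}) : P :=
  \sum_(s in C) (-1) ^+ s *: palg_basis delta (perm_diagram s).

Lemma act_sumE (W : lmodType k) (act : 'S_n -> W -> W) (C : {set 'S_n}) (c : 'S_n -> k) w :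
  act_sum act (\sum_(s in C) c s *: palg_basis delta (perm_diagram s) : P) w =
  \sum_(s in C) c s *: act s w.
Proof.
rewrite /act_sum [RHS]big_mkcond; apply: eq_bigr => s _.
rewrite sum_ffunE; have [sC|sC] := boolP (s \in C).
  rewrite (bigD1 s) //= !ffunE eqxx big1 ?addr0 => [|r /andP[_ rs]].
    by congr (_ *: _); exact: mulr1.
  rewrite !ffunE (inj_eq (@perm_diagram_inj n)) eq_sym (negPf rs); exact: mulr0.
rewrite big1 ?scale0r // => r rC.
rewrite !ffunE (inj_eq (@perm_diagram_inj n)) eq_sym; case: eqP => [e|_]; last exact: mulr0.
by rewrite -e rC in sC.
Qed.

Lemma act_sum_palg (W : lmodType k) (act : 'S_n -> W -> W) c s w :
  act_sum act (c *: palg_basis delta (perm_diagram s) : P) w = c *: act s w.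
Proof.
by have := act_sumE act [set s] (fun=> c) w; rewrite !big_set1.
Qed.

(** Through out, M is the subspace X of W with the action of 'S_n, on which all the
    diagrams that are not permutations act by 0. *)
Definition inflates (M : lmodType P) (W : lmodType k) (act : 'S_n -> W -> W)
    (X : W -> Prop) (out : M -> W) : Prop :=
  [/\ {morph out : x y / x + y}, injective out, forall w, X w <-> exists x, out x = w &
      forall a x, out (a *: x) = act_sum act a (out x)].

End Models.

(** With the number of cells of la in place of n, no cast between the entries of tableaux and
    the nodes of diagrams is needed. *)
Lemma specht_model (k : fieldType) (delta : k) (la : seq nat) :
  exists out : cell_module (sumn la) delta la -> {ffun {ffun 'I_(sumn la) -> 'I_(size la)} -> k^o},
  inflates (@permute k la) (fun f => f \in specht k la) out.
Proof.
have permute1 f : @permute k la 1 f = f.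
  apply/ffunP=> T; rewrite ffunE; congr (f _); apply/ffunP=> a.
  by rewrite ffunE invg1 perm1.
have [|s r x|out [outD outI outS outA]] := @tensor_module_full k (sumn la) delta _ (@specht_action k la).
- by move=> x; apply: subvs_inj; rewrite specht_actionE permute1.
- exact: specht_actionM.
exists (fun x => vsval (out x)); split.
- by move=> x y; rewrite outD.
- by move=> x y /subvs_inj/outI.
- move=> f; split=> [fS|[x <-]]; last exact: subvsP.
  by have [x xE] := outS (Subvs fS); exists x; rewrite xE.
- move=> a x; rewrite outA /act_sum linear_sum; apply: eq_bigr => s _.
  by rewrite linearZ /= specht_actionE.
Qed.

Definition hook_model (k : fieldType) (n : nat) (delta : k)
    (M : lmodType (partition_algebra n delta)) m (out : M -> {ffun {ffun 'I_m -> 'I_n} -> k^o}) :=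
  inflates (@move k n m) (@in_hook k n m) out.

Lemma hook_cell_model (k : fieldType) (delta : k) (h m n : nat) : (0 < h)%N ->
  sumn (h :: nseq m 1%N) = n ->
  exists out : cell_module n delta (h :: nseq m 1%N) -> _, @hook_model k n delta _ m out.
Proof.
move=> h0 <-{n}; have: size (nseq m 1%N) = m by rewrite size_nseq.
have: all (pred1 1%N) (nseq m 1%N) by rewrite all_pred1_nseq.
move: (nseq m 1%N) => l l1 <-{m}.
have [out [outD outI outS outA]] := specht_model delta (h :: l).
pose flat := @flatten_tabloids k h l.
have flat0 : flat 0 = 0 by apply/ffunP=> x; rewrite !ffunE if_same.
have flatD f g : flat (f + g) = flat f + flat g.
  by rewrite -[f]scale1r [LHS]flatten_tabloids_lincomb scale1r scale1r.
have flatZ c f : flat (c *: f) = c *: flat f.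
  by rewrite -[_ *: f]addr0 [LHS]flatten_tabloids_lincomb -/flat flat0 addr0.
exists (fun x => flat (out x)); split.
- by move=> x y; rewrite outD flatD.
- move=> x y e; apply/outI/(flatten_tabloids_inj h0 l1) => //.
    by apply/outS; exists x.
  by apply/outS; exists y.
- move=> F; split=> [/(flatten_specht h0 l1)[f /outS[x <-] <-]|[x <-]]; first by exists x.
  by apply/(flatten_specht h0 l1); exists (out x) => //; apply/outS; exists x.
- move=> a x; rewrite outA /act_sum (big_morph flat flatD flat0); apply: eq_bigr => s _.
  by rewrite flatZ /flat flatten_tabloids_permute.
Qed.

Section Inflated.
Variables (k : fieldType) (n : nat) (delta : k).
Local Notation P := (partition_algebra n delta).
Variables (W : lmodType k) (act : 'S_n -> W -> W) (X : W -> Prop).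
Variables (M : lmodType P) (out : M -> W).
Hypothesis Mout : inflates act X out.
Hypothesis act1 : forall w, act 1%g w = w.

Lemma inflates0 : out 0 = 0.
Proof.
case: Mout => outD _ _ _; apply: (addrI (out 0)).
by rewrite -outD !addr0.
Qed.

Lemma inflates_lincomb (U : submodule M) x y c : x \in U -> y \in U ->
  exists2 z, z \in U & out z = c *: out x + out y.
Proof.
move=> xU yU; case: Mout => outD _ _ outA.
exists ((c *: palg_basis delta (perm_diagram 1) : P) *: x + y); first exact: submodZD.
by rewrite outD outA act_sum_palg act1.
Qed.

Lemma inflates_scale (U : submodule M) x y c : c != 0 -> x \in U -> out x = c *: out y -> y \in U.
Proof.
move=> c0 xU e; have [outD outI _ _] := Mout.
have [z zU ze] := inflates_lincomb c^-1 xU (submod0 U).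
suff -> : y = z by [].
by apply: outI; rewrite ze e scalerA mulVf // scale1r inflates0 addr0.
Qed.

Lemma inflates_act (U : submodule M) x s : x \in U ->
  exists2 z, z \in U & out z = act s (out x).
Proof.
move=> xU; have [_ _ _ outA] := Mout.
exists ((1 *: palg_basis delta (perm_diagram s) : P) *: x); first exact: submodZ.
by rewrite outA act_sum_palg scale1r.
Qed.

Lemma inflates_full (U : submodule M) : 
  (forall w, X w -> exists2 x, x \in U & out x = w) -> U =i predT.
Proof.
case: Mout => _ outI outX _ H x; rewrite [RHS]inE.
have [|z zU /outI <- //] := H (out x).
by apply/outX; exists x.
Qed.

Lemma inflates_perm (d : diagram n) (x : M) : (forall s, d <> perm_diagram s) -> palg_basis delta d *: x = 0.
Proof.
case: Mout => _ outI _ outA H; apply: outI; rewrite outA inflates0 /act_sum big1 // => s _.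
by rewrite ffunE; case: eqP => [e|]; rewrite ?scale0r //; case: (H s).
Qed.

Lemma inflates_signed (C : {set 'S_n}) x :
  out (signed_sum delta C *: x) = \sum_(s in C) (-1) ^+ s *: act s (out x).
Proof. by case: Mout => _ _ _ outA; rewrite outA [LHS]act_sumE. Qed.

End Inflated.

(** * The complex of hook modules *)

Section HookModules.
Variables (k : fieldType) (n : nat) (delta : k).
Local Notation P := (partition_algebra n delta).
Hypotheses (two_neq0 : 2%:R != 0 :> k) (n0 : n%:R = 0 :> k) (n_gt0 : (0 < n)%N).

Let move1 m (F : {ffun {ffun 'I_m -> 'I_n} -> k^o}) : move 1 F = F.
Proof. by apply/ffunP=> x; rewrite ffunE; congr (F _); apply/ffunP=> a; rewrite !ffunE perm1. Qed.

Lemma wedge_map m (M N : lmodType P) (outM : M -> _) (outN : N -> _) :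
  @hook_model k n delta M m outM -> @hook_model k n delta N m.+1 outN ->
  exists theta : {linear M -> N}, forall x, outN (theta x) = wedge (outM x).
Proof.
case=> MD MI MX MA [ND NI NX NA].
have ex x : exists y, outN y = wedge (outM x).
  by apply/NX/in_hook_wedge => //; apply/MX; exists x.
pose f x := sval (cid (ex x)).
have fE x : outN (f x) = wedge (outM x) by exact: svalP (cid (ex x)).
have [theta thetaE] : exists g : {linear M -> N}, g =1 f.
  apply: linear_map_exists => a x y; apply: NI.
  rewrite ND NA !fE MD MA wedgeD; congr (_ + _).
  rewrite /act_sum (big_morph (@wedge k n m) (@wedgeD k n m) (id1 := 0)); last first.
    by rewrite -(scale0r 0) wedgeZ scale0r.
  by apply: eq_bigr => s _; rewrite wedgeZ wedge_move.
by exists theta => x; rewrite thetaE.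
Qed.

Section Generation.
Variables (m : nat) (M : lmodType P) (out : M -> {ffun {ffun 'I_m -> 'I_n} -> k^o}).
Hypothesis Mout : hook_model out.
Hypothesis m_fact : m`!%:R != 0 :> k.

Lemma out_leg_sum (I : {ffun 'I_m.+1 -> 'I_n}) (Iinj : injective I) x :
  out (signed_sum delta [set extend_perm Iinj r | r : 'S_m.+1] *: x) =
  (m`!%:R * wedge (out x) I) *: hook_vec k I.
Proof.
have [_ _ outX _] := Mout.
rewrite (inflates_signed Mout) big_imset /=; last by move=> ? ? _ _; apply: extend_perm_inj.
rewrite -(antisymmetrizeE Iinj) //; last by apply/outX; exists x.
by apply: eq_big => // r _; rewrite odd_extend_perm.
Qed.

(** Antisymmetrisation over a simplex I on which the product of x is non-zero puts
    the generator attached to I in U, and the symmetric group is transitive on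
    simplices. *)
Lemma hook_generates (U : submodule M) x : x \in U -> wedge (out x) <> 0 -> U =i predT.
Proof.
move=> xU wx; have [_ _ outX _] := Mout.
have xK : in_hook (out x) by apply/outX; exists x.
have [I Iinj wI] := wedge_neq0 two_neq0 n0 xK wx.
have [y yE] : exists y, out y = hook_vec k I by apply/outX/in_hook_vec.
have yU : y \in U.
  apply: (inflates_scale Mout (@move1 m) (c := m`!%:R * wedge (out x) I)
    (x := signed_sum delta [set extend_perm Iinj r | r : 'S_m.+1] *: x)).
  - by rewrite mulf_neq0.
  - exact: submodZ.
  by rewrite out_leg_sum yE.
apply: (inflates_full Mout); apply: in_hook_ind => [|c F G [u uU <-] [v vU <-]|J].
- by exists 0; [exact: submod0 | exact: inflates0 Mout].
- exact (inflates_lincomb Mout (@move1 m) c uU vU).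
have [/injectiveP Jinj|/injectivePn[b [c bc e]]] := boolP (injectiveb J); last first.
  by exists 0; [exact: submod0 | rewrite (inflates0 Mout) (hook_vec_noninj _ bc e)].
have [s sE] := perm_between Jinj Iinj.
have [z zU zE] := inflates_act Mout s yU; exists z => //.
rewrite zE yE move_hook_vec; congr (hook_vec k _); apply/ffunP=> b.
by rewrite ffunE -sE permK.
Qed.

Lemma hook_vec_not_wedge0 (I : {ffun 'I_m.+1 -> 'I_n}) : injective I -> m.+1%:R != 0 :> k ->
  wedge (hook_vec k I) <> 0.
Proof.
move=> Iinj m1 /ffunP/(_ I); rewrite wedge_hook_vec_base // ffunE.
by move/eqP; rewrite (negPf m1).
Qed.

Variables (N : lmodType P) (outN : N -> {ffun {ffun 'I_m.+1 -> 'I_n} -> k^o}).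
Hypothesis NoutN : hook_model outN.
Variable theta : {linear M -> N}.
Hypothesis thetaE : forall x, outN (theta x) = wedge (out x).

Lemma theta_eq0 x : theta x = 0 <-> wedge (out x) = 0.
Proof.
have [_ outI _ _] := NoutN; rewrite -thetaE -(inflates0 NoutN).
by split=> [->|/outI].
Qed.

Lemma kernel_max (U : submodule M) : U =i predT \/ {subset U <= kernel theta}.
Proof.
have [fU|nU] := pselect (U =i predT); [by left | right=> x xU].
rewrite in_kernel; apply/eqP/theta_eq0; apply: contrapT => wx.
exact/nU/(hook_generates xU).
Qed.

Lemma kernel_proper : (m.+1 <= n)%N -> m.+1%:R != 0 :> k -> ~ (kernel theta =i predT).
Proof.
move=> mn m1 full; have [_ _ outX _] := Mout.
pose I : {ffun 'I_m.+1 -> 'I_n} := [ffun b => widen_ord mn b].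
have Iinj : injective I by move=> b c; rewrite !ffunE => /(congr1 val) e; apply: val_inj.
have [x xE] : exists x, out x = hook_vec k I by apply/outX/in_hook_vec.
have := full x; rewrite [RHS]inE in_kernel => /eqP/theta_eq0.
by rewrite xE; apply: hook_vec_not_wedge0.
Qed.

End Generation.

Lemma wedge_map_exact m (M N : lmodType P) outM outN (theta : {linear M -> N}) y :
  @hook_model k n delta M m outM -> @hook_model k n delta N m.+1 outN ->
  (forall x, outN (theta x) = wedge (outM x)) ->
  wedge (outN y) = 0 <-> exists x, theta x = y.
Proof.
move=> Mo No thE; have [_ MI MX _] := Mo; have [_ NI NX _] := No.
split=> [wy|[x <-]].
  have yK : in_hook (outN y) by apply/NX; exists y.
  have [G /MX[x <-] e] := wedge_exact yK wy n_gt0.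
  by exists x; apply: NI; rewrite thE.
by rewrite thE wedge_wedge.
Qed.

End HookModules.

(** * Signed sums over column stabilizers *)

Definition column_group n (col : 'I_n -> nat) : {set 'S_n} :=
  [set s : 'S_n | [forall a, col (s a) == col a]].

Lemma column_groupP n (col : 'I_n -> nat) (s : 'S_n) :
  reflect (forall a, col (s a) = col a) (s \in column_group col).
Proof. by rewrite inE; apply: (iffP forallP) => H a; apply/eqP; rewrite ?H. Qed.

Lemma column_group_set n (col : 'I_n -> nat) : group_set (column_group col).
Proof.
apply/group_setP; split=> [|s r /column_groupP sC /column_groupP rC].
  by apply/column_groupP=> a; rewrite perm1.
by apply/column_groupP=> a; rewrite permM rC sC.
Qed.

Canonical column_groupG n (col : 'I_n -> nat) := Group (column_group_set col).

(** An element of order n of the symmetric group of degree n, for n prime, is an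
    n-cycle; its powers move every entry to every other one, so it preserves col only
    if col is constant. *)
Lemma column_group_coprime n (col : 'I_n -> nat) : prime n ->
  (exists a b, col a != col b) -> ~~ (n %| #|column_group col|)%N.
Proof.
move=> pn [a [b]]; apply: contra => /(Cauchy pn)[s /column_groupP sC os].
have [c sc] : exists c, s c != c.
  apply/existsP; apply: contraT; rewrite -negb_forall negbK => /forallP s1.
  have e : s = 1%g by apply/permP=> c; rewrite perm1; apply/eqP.
  by rewrite e order1 in os; rewrite -os in pn.
have cn : #|porbit s c| = n.
  have : (#|porbit s c| %| #[s]%g)%N by rewrite porbitE; apply: dvdn_orbit.
  rewrite os; case/primeP: pn => _ H /H/orP[/eqP c1|/eqP//].
  have /cards1P[z zE] : #|porbit s c| == 1%N by rewrite c1.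
  have := porbit_id s c; have := mem_porbit s 1 c.
  by rewrite zE !inE expg1 => /eqP e /eqP e'; rewrite e e' eqxx in sc.
have colc y : col y = col c.
  have : y \in porbit s c.
    have /eqP -> : porbit s c == setT by rewrite eqEcard subsetT cardsT card_ord cn leqnn.
    by rewrite inE.
  case/porbitP=> i ->; elim: i => [|i IH]; first by rewrite expg0 perm1.
  by rewrite expgSr permM sC.
by rewrite !colc.
Qed.

Lemma pigeonhole (T : finType) (A : {set T}) (b : nat) (f : T -> nat) :
  (b < #|A|)%N -> (forall x, x \in A -> (f x < b)%N) ->
  exists x y, [/\ x \in A, y \in A, x != y & f x = f y].
Proof.
move=> bA fb; case: b => [|b] in bA fb *.
  by move/card_gt0P: bA => [x /fb].
have /imset_injP H : ~~ (#|[set (inord (f x) : 'I_b.+1) | x in A]| == #|A|).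
  rewrite neq_ltn (leq_ltn_trans _ bA) //.
  by rewrite -[X in (_ <= X)%N](card_ord b.+1) max_card.
apply: contrapT => no; apply: H => x y xA yA e; apply/eqP; apply: contraT => xy.
case: no; exists x, y; split=> //.
by move/(congr1 (@nat_of_ord _)): e; rewrite !inordK ?fb.
Qed.

Section ColumnArguments.
Variables (k : fieldType) (delta : k).
Hypothesis two_neq0 : 2%:R != 0 :> k.

(** A tuple of m entries leaves more than b entries out, so two of these lie in the
    same column; their transposition fixes the tuple and belongs to the group. *)
Lemma column_group_kills n m (M : lmodType (partition_algebra n delta)) out
    (col : 'I_n -> nat) b :
  @hook_model k n delta M m out -> (forall i, (col i < b)%N) -> (b + m < n)%N ->
  forall x : M, signed_sum delta (column_group col) *: x = 0.
Proof.
move=> Mout colb bn x; have [_ outI _ _] := Mout; apply: outI.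
rewrite (inflates_signed Mout) (inflates0 Mout); move: (out x) => F.
apply/ffunP=> y; rewrite sum_ffunE [RHS]ffunE.
have cX : (#|[set y a | a : 'I_m]| <= m)%N.
  by rewrite (leq_trans (leq_imset_card _ _)) // cardT size_enum_ord.
have [|z [w [zy wy zw e]]] := pigeonhole (A := ~: [set y a | a : 'I_m]) (b := b) _ (fun x _ => colb x).
  rewrite -(ltn_add2l #|[set y a | a : 'I_m]|) cardsC card_ord.
  by apply: leq_ltn_trans bn; rewrite addnC leq_add2l.
have out_y u : u \in ~: [set y a | a : 'I_m] -> forall a, u != y a.
  by rewrite inE => uy a; apply: contraNneq uy => ->; apply: imset_f.
transitivity (\sum_(s in column_group col) (-1) ^+ s * F (tuple_move s y)).
  by apply: eq_bigr => s _; rewrite !ffunE.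
apply: (@signed_sum_vanish _ _ _ (tperm z w)) => //; first by rewrite odd_tperm.
  move=> s; apply: (@groupMl _ (column_groupG col)); apply/column_groupP=> a.
  by case: tpermP => [->|->|] //.
move=> s; congr (F _); apply/ffunP=> a.
by rewrite !ffunE permM tpermD ?out_y.
Qed.

(** Two of the m + 1 entries of I lie in the same row of a tabloid with at most m
    rows, and their transposition fixes this tabloid. *)
Lemma leg_group_kills la m n (I : {ffun 'I_m.+1 -> 'I_n}) (Iinj : injective I) :
  sumn la = n -> (size la <= m)%N ->
  forall x : cell_module n delta la,
    signed_sum delta [set extend_perm Iinj r | r : 'S_m.+1] *: x = 0.
Proof.
move=> e; case: n / e I Iinj => I Iinj lam x.
have [out Mout] := specht_model delta la; have [_ outI _ _] := Mout; apply: outI.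
rewrite (inflates_signed Mout) (inflates0 Mout); move: (out x) => F.
rewrite big_imset /=; last by move=> ? ? _ _; apply: extend_perm_inj.
apply/ffunP=> X; rewrite sum_ffunE [RHS]ffunE.
have [|b [c [_ _ bc e]]] := pigeonhole (A := [set: 'I_m.+1]) (b := size la)
    (f := fun b => X (I b)) _ (fun b _ => ltn_ord _).
  by rewrite cardsT card_ord.
transitivity (\sum_(r in [set: 'S_m.+1]) (-1) ^+ r * permute (extend_perm Iinj r) F X).
  by apply: eq_big => [r|r _]; rewrite ?inE // ffunE odd_extend_perm.
apply: (@signed_sum_vanish _ _ _ (tperm b c)) => //; first by rewrite odd_tperm.
  by move=> r; rewrite !inE.
move=> r; rewrite !ffunE; congr (F _); apply/ffunP=> a; rewrite !ffunE.
rewrite extend_permM invMg permM extend_tperm tpermV.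
by case: tpermP => [->|->|] //; apply: val_inj; rewrite /= e.
Qed.

(** The group is the column stabilizer of the tableau 1, and the signed sum over it
    multiplies the polytabloid of 1 by the order of the group. This order is
    invertible in k by column_group_coprime: as la is not (1^n), some row has two
    cells, which lie in different columns. The polytabloid of 1 generates the
    Specht module. *)
Lemma column_group_generates la n (pn : prime n) (nk : n \in [pchar k]) :
  sumn la = n -> is_partition la -> la != nseq n 1%N ->
  exists col : 'I_n -> nat, (forall i, (col i < head 0%N la)%N) /\
    forall U : submodule (cell_module n delta la),
      (forall x, signed_sum delta (column_group col) *: x \in U) -> U =i predT.
Proof.
move=> e; case: n / e pn nk => pn nk /andP[la_sorted la_pos] la1.
exists (@col_of la); split.
  have le_head r : (nth 0%N la r <= head 0%N la)%N.
    case: (la) la_sorted r => [|h l] /=; first by move=> _ r; rewrite nth_nil.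
    move=> /(order_path_min (rev_trans leq_trans)) /allP hl [//|r] /=.
    by case: (ltnP r (size l)) => rl; [apply/hl/mem_nth | rewrite nth_default].
  move=> i; exact: leq_trans (reshape_offsetP (ltn_ord i)) (le_head _).
move=> U CU; have [out Mout] := specht_model delta la; have [_ _ outX _] := Mout.
set C := column_group _ in CU.
have CE : column_stabilizer 1 = C.
  by apply/setP=> s; rewrite !inE; apply: eq_forallb => a; rewrite invg1 !perm1.
have card_C : #|C|%:R != 0 :> k.
  rewrite -(dvdn_pcharf nk); apply: column_group_coprime => //.
  have [x xla x1] : exists2 x, x \in la & (1 < x)%N.
    apply/hasP; apply: contraNT la1 => /hasPn H.
    have /all_pred1P laE : all (pred1 1%N) la.
      apply/allP=> x xla /=; rewrite eqn_leq leqNgt H //= lt0n.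
      by apply: contraNneq la_pos => <-.
    by rewrite laE sumn_nseq mul1n eqxx.
  have ltr c : (c < 2)%N -> (c < nth 0%N la (index x la))%N.
    by move=> c2; rewrite nth_index // (leq_trans c2).
  (* The first two cells of a row of length x. *)
  exists (Ordinal (flatten_indexP (ltr 0%N isT))), (Ordinal (flatten_indexP (ltr 1%N isT))).
  by rewrite /col_of /= !flatten_indexKr // ltr.
have permC s : s \in C -> permute s (polytabloid k 1) = (-1) ^+ s *: polytabloid k (1 : 'S_(sumn la)).
  move=> sC; rewrite /polytabloid CE linear_sum /= scaler_sumr.
  rewrite (reindex_inj (mulIg s)) /=; apply: eq_big => r.
    exact: (@groupMr _ (column_groupG _)).
  by move=> _; rewrite linearZ /= permute_tabloid odd_permM signr_addb mulgA mulgK mulrC scalerA.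
have permute1 f : @permute k la 1 f = f.
  apply/ffunP=> T; rewrite ffunE; congr (f _); apply/ffunP=> a.
  by rewrite ffunE invg1 perm1.
have [y yE] : exists y, out y = polytabloid k 1 by apply/outX/polytabloid_specht.
have yU : y \in U.
  apply: (inflates_scale Mout permute1 (c := #|C|%:R) (x := signed_sum delta C *: y)) => //.
  rewrite (inflates_signed Mout) yE -sum1_card natr_sum scaler_suml.
  by apply: eq_bigr => s sC; rewrite permC // scalerA -expr2 sqrr_sign.
apply: (inflates_full Mout); apply: specht_ind => [|c f g [u uU <-] [v vU <-]|T].
- by exists 0; [exact: submod0 | exact: inflates0 Mout].
- exact (inflates_lincomb Mout permute1 c uU vU).
have [z zU zE] := inflates_act Mout T^-1%g yU; exists z => //.
by rewrite zE yE permute_polytabloid invgK mul1g.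
Qed.
End ColumnArguments.

(** * Cell modules of partitions of smaller numbers *)

Section Truncated.
Variables (n t : nat).

(** The nodes with equal keys form a block: i is joined to its southern copy if
    i < t, and all the other nodes are singletons. *)
Definition truncation_key (a : node n) : 'I_n * bool :=
  match a with inl i => (i, true) | inr j => (j, (j < t)%N) end.

Definition truncated_id : diagram n :=
  Diagram (preim_partitionP truncation_key [set: node n]).

Lemma same_truncated a b : same_block truncated_id a b = (truncation_key a == truncation_key b).
Proof. exact: same_preim. Qed.

Lemma cell_truncated : (t <= n)%N -> cell_diagram t truncated_id.
Proof.
move=> tn; apply/andP; split; last first.
  apply/forallP=> j; apply/implyP=> tj; apply/same_singleton=> b; rewrite same_truncated.
  by case: b => i; rewrite /truncation_key ltnNge tj; case/eqP=> // ->.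
pose f (i : 'I_t) := pblock truncated_id (inl (widen_ord tn i)).
have finj : injective f.
  move=> i j /eqP; rewrite -same_blockE same_truncated => /eqP[] e; exact: val_inj.
have -> : propagating truncated_id = f @: setT.
  apply/setP=> B; apply/propagatingP/imsetP=> [[i [j [-> _]]]|[i _ ->]].
    rewrite same_truncated => /eqP[e] /esym jt.
    by exists (Ordinal jt); rewrite // /f; congr (pblock _ (inl _)); rewrite e; apply: val_inj.
  have ii : same_block truncated_id (inl (widen_ord tn i)) (inr (widen_ord tn i)).
    by rewrite same_truncated /= ltn_ord.
  by exists (widen_ord tn i), (widen_ord tn i); split=> //; apply/eqP; rewrite -same_blockE.
by rewrite card_imset // cardsT card_ord.
Qed.

(** The middle and bottom nodes with the same number are joined, except for the
    numbers at least t, where the southern node is a singleton of v anyway. *)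
Lemma compose_truncated v : cell_diagram t v -> compose v truncated_id = v.
Proof.
case/andP=> _ /forallP sv; apply: diagram_ext => a b; rewrite same_compose.
pose flat (u : stack n) : node n :=
  match u with inl (inl i) => inl i | inl (inr j) => inr j | inr j => inr j end.
have flat_outer c : flat (outer c) = c by case: c.
have flat_upper c : flat (upper c) = c by case: c.
apply/idP/idP=> [ab|].
  rewrite -(flat_outer b).
  apply: (glued_ind (Q := fun u => same_block v a (flat u)) _ _ ab) => [c d cd|c d|].
  - by rewrite !flat_upper => ac; rewrite (same_left ac).
  - have flat_lower e : flat (lower e) = inr (truncation_key e).1 by case: e.
    by rewrite same_truncated !flat_lower => /eqP->.
  - by rewrite flat_outer same_refl.
have to_upper c : (forall d, same_block v c d -> d = c) \/
    connect (glued v truncated_id) (outer c) (upper c).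
  case: c => [i|j]; first by right; apply: connect0.
  have [tj|jt] := leqP t j; first by left; apply/same_singleton; apply: (implyP (sv j)).
  right; apply: (@glued_lower _ v truncated_id (inr j) (inl j)).
  by rewrite same_truncated /= jt.
move=> ab; case: (to_upper a) => [/(_ b ab)->|oa]; first exact: connect0.
rewrite same_sym in ab; case: (to_upper b) => [/(_ a ab)->|ob]; first exact: connect0.
rewrite (same_connect (glued_sym v truncated_id) oa).
rewrite (glued_sym v truncated_id).
rewrite (same_connect (glued_sym v truncated_id) ob).
exact: glued_upper.
Qed.

End Truncated.

(** A basis diagram v of V(n,t) acts on the truncated identity, itself in this
    basis, and returns v up to a power of delta; but v has only t < n propagating
    blocks, so it is not a permutation diagram and acts by 0 on N. *)
Lemma cell_module_annihilated (k : fieldType) (delta : k) (n : nat) (la : seq nat)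
    (N : lmodType (partition_algebra n delta)) (f : {linear cell_module n delta la -> N}) :
  delta != 0 -> (sumn la < n)%N ->
  (forall (d : diagram n) (y : N), (forall s, d <> perm_diagram s) -> palg_basis delta d *: y = 0) ->
  forall x, f x = 0.
Proof.
move=> d0 lan kill x.
set t := sumn la in lan *.
have [q [qsurj kerq]] := quotient_map (balanced_submodule n delta (@specht_action k la)).
have [g gE] : exists g : {linear free_cell_module n t delta _ -> N}, forall y, g y = f (q y).
  by exists (f \o q)%FUN.
have [y <-] := qsurj x; rewrite -gE -(pure_tensorE y) linear_sum big1 // => v _.
have e0 := cell_truncated (ltnW lan).
(* The power of delta undoes the loops closed when v is put on top of the
   truncated identity. *)
have -> : pure_tensor t (val v) (y v) =
  (delta ^- loops (val v) (truncated_id n t) *: palg_basis delta (val v)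
     : partition_algebra n delta) *:
  (pure_tensor t (truncated_id n t) (y v) : free_cell_module n t delta _).
  rewrite [RHS](cell_scale_pure _ _ e0) (bigD1 (val v)) //= !ffunE eqxx.
  rewrite [_ *: 1]mulr1 mulVf ?expf_neq0 // scale1r compose_truncated ?(valP v) //.
  rewrite big1 ?addr0 // => x' /negPf xv; rewrite !ffunE xv [_ *: 0]mulr0 mul0r scale0r //.
rewrite linearZ /= -mulr_algl -scalerA kill ?scaler0 // => s e.
have /andP[/eqP pv _] := valP v; have : cell_diagram n (val v) by apply/cell_diagram_full; exists s.
by case/andP; rewrite pv => /eqP tn _; case/eqP: (negbT (ltn_eqF lan)).
Qed.

Lemma size_le_sumn l : 0%N \notin l -> (size l <= sumn l)%N.
Proof.
elim: l => //= x l IH; rewrite inE negb_or eq_sym -lt0n => /andP[x0 /IH].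
by rewrite -add1n; apply: leq_add.
Qed.

Lemma nseq1_of_sumn_le l : 0%N \notin l -> (sumn l <= size l)%N -> l = nseq (size l) 1%N.
Proof.
move=> l0 sl; apply/all_pred1P; elim: l l0 sl => //= x l IH.
rewrite inE negb_or eq_sym -lt0n => /andP[x0 l0] xl; have sl := size_le_sumn l0.
have x1 : (x <= 1)%N.
  by rewrite -(leq_add2r (sumn l)) (leq_trans xl) // -add1n leq_add2l.
rewrite eqn_leq x1 x0 IH //; rewrite -add1n in xl.
by rewrite -(leq_add2l x) (leq_trans xl) // leq_add2r.
Qed.

(** The first row and the other rows contribute at least n - m and m to the sum n,
    so both bounds are attained. *)
Lemma hook_partition_of_bounds n m la : is_partition la -> sumn la = n ->
  (n - m <= head 0%N la)%N -> (m < size la)%N -> la = (n - m)%N :: nseq m 1%N.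
Proof.
case: la => [|h l] //= /andP[_]; rewrite inE negb_or ltnS => /andP[_ l0] s hb ml.
have sl := size_le_sumn l0.
have lm : (sumn l <= m)%N by move: hb; rewrite -s leq_subLR addnC leq_add2r.
have size_l : size l = m by apply/eqP; rewrite eqn_leq ml (leq_trans sl).
have sumn_l : sumn l = m by apply/eqP; rewrite eqn_leq lm -{1}size_l sl.
have -> : h = (n - m)%N by rewrite -s sumn_l addnK.
by rewrite [l in LHS]nseq1_of_sumn_le ?size_l // sumn_l.
Qed.

(** There is no simplex with more than n vertices. *)
Lemma wedge_top (k : fieldType) n m (F : {ffun {ffun 'I_m -> 'I_n} -> k^o}) :
  n%:R = 0 :> k -> (n <= m.+1)%N -> in_hook F -> wedge F = 0.
Proof.
move=> n0 nm; move: F; apply: in_hook_ind => [|c F G HF HG|I].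
- by rewrite -(scale0r 0) wedgeZ scale0r.
- by rewrite wedgeD wedgeZ HF HG scaler0 addr0.
rewrite wedge_hook_vec // big1 ?oppr0 // => y _.
have /injectivePn[b [c bc e]] : ~~ injectiveb (tuple_cons y I).
  apply/negP=> /injectiveP/leq_card; rewrite !card_ord => H.
  by move: (leq_trans H nm); rewrite ltnn.
exact: hook_vec_noninj bc e.
Qed.

(** * Composition factors of the hook cell modules *)

Section HookComposition.
Variables (k : fieldType) (p : nat).
Hypotheses (pk : p \in [pchar k]) (p_gt2 : (2 < p)%N).

Notation delta := ((p - 1)%:R : k).
Notation hook m := ((p - m)%N :: nseq m 1%N).
Notation Delta la := (cell_module p delta la).
Notation L la := (simple_head p delta la).

Let p_prime : prime p. Proof. exact: pcharf_prime pk. Qed.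
Let p0 : p%:R = 0 :> k. Proof. exact: pcharf0 pk. Qed.

Lemma natr_neq0 j : (0 < j)%N -> (j < p)%N -> j%:R != 0 :> k.
Proof. by move=> j0 jp; rewrite -(dvdn_pcharf pk) gtnNdvd. Qed.

Let two_neq0 : 2%:R != 0 :> k. Proof. exact: natr_neq0. Qed.

Lemma fact_neq0 j : (j < p)%N -> j`!%:R != 0 :> k.
Proof.
elim: j => [|j IH] jp; first by rewrite oner_neq0.
by rewrite factS natrM mulf_neq0 //; [apply: natr_neq0 | apply/IH/ltnW].
Qed.

Let delta_neq0 : delta != 0.
Proof. by apply: natr_neq0; rewrite ?subn_gt0 ?ltn_subrL //= ?prime_gt1 ?prime_gt0. Qed.

Lemma hook_model_ex m : (m < p)%N ->
  exists out : Delta (hook m) -> _, @hook_model k p delta _ m out.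
Proof.
move=> mp; apply: hook_cell_model; first by rewrite subn_gt0.
by rewrite /= sumn_nseq mul1n subnK // ltnW.
Qed.

Lemma radical_hook_cell m out : (m.+1 < p)%N -> @hook_model k p delta (Delta (hook m)) m out ->
  simple_module (L (hook m)) /\
  forall x : Delta (hook m), x \in radical (Delta (hook m)) <-> wedge (out x) = 0.
Proof.
move=> mp Mout; have [outN NoutN] := hook_model_ex mp.
have [theta thetaE] := wedge_map p0 Mout NoutN.
have proper : ~ (kernel theta =i predT).
  by apply: (kernel_proper p0 Mout NoutN thetaE); rewrite ?natr_neq0 // ltnW.
have maxi := kernel_max two_neq0 p0 Mout (fact_neq0 (ltnW mp)) NoutN thetaE.
split; first exact: simple_module_head proper maxi.
move=> x; rewrite (radical_unique_max proper maxi) in_kernel.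
by rewrite -(theta_eq0 NoutN thetaE); split=> [/eqP|->].
Qed.

Lemma hook_chain m : (m.+1 < p)%N ->
  exists theta : {linear Delta (hook m) -> Delta (hook m.+1)},
  [/\ forall x, theta x = 0 <-> x \in radical (Delta (hook m)),
      (m.+2 < p)%N -> forall y, y \in radical (Delta (hook m.+1)) <-> exists x, theta x = y &
      m.+2 = p -> forall y, exists x, theta x = y].
Proof.
move=> mp; have [outM MoutM] := hook_model_ex (ltnW mp).
have [outN NoutN] := hook_model_ex mp.
have [theta thetaE] := wedge_map p0 MoutM NoutN.
have exact_at y := wedge_map_exact (ltnW (ltnW p_gt2)) y MoutM NoutN thetaE.
exists theta; split=> [x|mp' y|mp' y].
- by rewrite (radical_hook_cell mp MoutM).2 (theta_eq0 NoutN thetaE).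
- by rewrite (radical_hook_cell mp' NoutN).2.
apply/exact_at/wedge_top; rewrite ?mp' //.
by have [_ _ outX _] := NoutN; apply/outX; exists y.
Qed.

(** Smaller partitions are excluded by diagrams that are not permutations, and
    a partition of p with too few columns or rows by the signed sums over its
    columns or over the leg of the hook. *)
Lemma head_hook_inj m la : (m.+1 < p)%N -> regular_partition_le p p la ->
  isomorphic (L (hook m)) (L la) -> la = hook m.
Proof.
move=> mp /and3P[la_part la_le la_reg] iso_mla.
have [out Mout] := hook_model_ex (ltnW mp).
(* The non-zero element z of the head of S_m contradicts each case where la is not
   the hook. *)
have [[[z z0] _] radE] := radical_hook_cell mp Mout.
have [la_lt|p_le] := ltnP (sumn la) p.
  have [f [g _ gK]] := isomorphic_sym iso_mla.
  have [q [q_surj _]] := quotient_map (radical (Delta la)).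
  have fq0 := @cell_module_annihilated k delta p la (L (hook m)) (f \o q)%FUN delta_neq0 la_lt.
  have [x xE] := q_surj (g z).
  case/eqP: z0; rewrite -(gK z) -xE; apply: fq0 => d y dP.
  have [qm [qm_surj _]] := quotient_map (radical (Delta (hook m))).
  have [w <-] := qm_surj y.
  by rewrite -linearZ /= (inflates_perm Mout w dP) linear0.
have {la_le p_le} sum_la : sumn la = p by apply/eqP; rewrite eqn_leq la_le.
apply: hook_partition_of_bounds => //.
- have [//|head_lt] := leqP (p - m) (head 0%N la).
  have la1 : la != nseq p 1%N.
    apply: contraTneq la_reg => ->; apply/allPn; exists 1%N.
      by rewrite mem_nseq eqxx prime_gt0.
    by rewrite count_nseq mul1n ltnn.
  have [col [colb gen]] := column_group_generates delta p_prime pk sum_la la_part la1.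
  have full : radical (Delta la) =i predT.
    apply/gen/(head_kills iso_mla).
    apply: (column_group_kills two_neq0 Mout colb).
    by rewrite addnC -ltn_subRL.
  have [f [g fK _]] := iso_mla.
  have [q [q_surj kerq]] := quotient_map (radical (Delta la)).
  have [x xE] := q_surj (f z); case/eqP: z0.
  rewrite -(fK z) -xE; have -> : q x = 0 by apply/kerq; rewrite full.
  by rewrite -(linear0 f) fK.
have [//|la_short] := ltnP m (size la).
pose I : {ffun 'I_m.+1 -> 'I_p} := [ffun b => widen_ord (ltnW mp) b].
have Iinj : injective I by move=> b c; rewrite !ffunE => /(congr1 val) e; apply: val_inj.
have [_ _ outX _] := Mout.
have [x xE] : exists x, out x = hook_vec k I by apply/outX/in_hook_vec.
have := head_kills (isomorphic_sym iso_mla) (leg_group_kills two_neq0 Iinj sum_la la_short) x.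
move/radE; rewrite (out_leg_sum two_neq0 Mout) xE wedgeZ wedge_hook_vec_base // => /eqP.
rewrite scaler_eq0 !mulf_eq0 (negPf (fact_neq0 (ltnW mp))) (negPf (natr_neq0 _ mp)) //=.
by move/eqP/(hook_vec_not_wedge0 p0 Iinj (natr_neq0 (ltn0Sn m) mp)).
Qed.

Lemma hook_composition_factors m la : (m.+2 < p)%N -> regular_partition_le p p la ->
  composition_multiplicity (Delta (hook m.+1)) (L la)
    ((la == hook m) + (la == hook m.+1)).
Proof.
move=> mp la_reg; have [theta [ker_theta im_theta _]] := hook_chain (ltnW mp).
have count j : (j.+1 < p)%N -> `[< isomorphic (L (hook j)) (L la) >] = (la == hook j).
  move=> jp; apply/asboolP/eqP=> [|->]; first exact: head_hook_inj.
  by exists idfun; exists id.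
rewrite -(count m (ltnW mp)) -(count m.+1 mp).
have simple_hook j : (j.+1 < p)%N -> simple_module (L (hook j)).
  by move=> jp; have [out /(radical_hook_cell jp)[]] := hook_model_ex (ltnW jp).
apply: (@composition_multiplicity_two _ _ (radical (Delta (hook m.+1)))).
- exact/simple_hook/ltnW.
- exact: simple_hook.
- apply: (subquotient_iso_head (f := theta)); first exact: im_theta.
  by move=> x; rewrite inE /= -ker_theta; split=> /eqP.
by apply: (subquotient_iso_head (f := idfun)) => // y; split=> // _; exists y.
Qed.

Lemma trivial_cell_module_simple : isomorphic (Delta (hook 0)) (L (hook 0)).
Proof.
have [out Mout] := hook_model_ex (prime_gt0 p_prime).
have [q [q_surj ker_q]] := quotient_map (radical (Delta (hook 0))).
apply: (isomorphic_of_surj (f := idfun) (g := q)) => [y|//|x]; first by exists y.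
rewrite ker_q (radical_hook_cell (prime_gt1 p_prime) Mout).2 /=.
split=> [->|/(wedge_inj0 (prime_gt0 p_prime))].
  by rewrite (inflates0 Mout) -(scale0r 0) wedgeZ scale0r.
by have [_ outI _ _] := Mout; rewrite -(inflates0 Mout) => /outI.
Qed.

(** The complex stops here: the product with sigma maps onto the sign module. *)
Lemma sign_cell_module_simple : isomorphic (Delta (hook (p - 2).+1)) (L (hook (p - 2))).
Proof.
have mp : ((p - 2).+2 = p)%N by rewrite -addn2 subnK // ltnW.
have [|theta [ker_theta _ im_theta]] := @hook_chain (p - 2); first by rewrite -{2}mp.
have [q [q_surj ker_q]] := quotient_map (radical (Delta (hook (p - 2)))).
apply: (isomorphic_of_surj (f := theta) (g := q)) => // [|x]; first exact: im_theta.
by rewrite ker_theta ker_q.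
Qed.

End HookComposition.

Theorem corollary5p18 (p : nat) (R : idomainType) (pi : R) (k : fieldType)
    (res : {rmorphism R -> k}) (sys : p_modular_system p pi res)
    (p_gt2 : (2 < p)%N) :
  let delta : k := (p - 1)%:R in
  let Delta := cell_module p delta in
  let L := simple_head p delta in
  [/\ forall (m : nat) (la : seq nat),
        (0 < m < p - 1)%N -> regular_partition_le p p la ->
        composition_multiplicity (Delta ((p - m)%N :: nseq m 1%N)) (L la)
          (if (la == (p - m)%N :: nseq m 1%N)
              || (la == (p - m + 1)%N :: nseq (m - 1) 1%N)
           then 1%N else 0%N),
      isomorphic (Delta [:: p]) (L [:: p]) &
      isomorphic (Delta (nseq p 1%N)) (L (2%N :: nseq (p - 2) 1%N))].
Proof.
move=> delta Delta L; have pk := pms_residue sys; split.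
- case=> [//|m] la /andP[_ mp] la_reg.
  have mp2 : (m.+2 < p)%N by move: mp; rewrite ltn_subRL add1n.
  rewrite subn1 /= (_ : p - m.+1 + 1 = p - m)%N; last by rewrite addn1 subnSK // ltnW // ltnW.
  have := hook_composition_factors pk p_gt2 mp2 la_reg.
  case: eqP => [->|_]; case: eqP => [e|_] //; exfalso.
  by move/(congr1 size): e => /=; rewrite !size_nseq => -[] /n_Sn.
- by have := trivial_cell_module_simple pk p_gt2; rewrite subn0.
have := sign_cell_module_simple pk p_gt2.
have mp : ((p - 2).+2 = p)%N by rewrite -addn2 subnK // ltnW.
have -> : (p - (p - 2).+1 = 1)%N by rewrite -[X in (X - _)%N]mp subSnn.
by rewrite subKn 1?ltnW // -[in nseq p _]mp.
Qed.
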